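(* The $(s,z,\ell)$-Temporal Cut problem admits a $2\log_2(2\ell)$-approximation algorithm; that is, there is a polynomial-time algorithm that, given a temporal graph $G=(V,E,\tau)$, distinct vertices $s,z\in V$ and a positive integer $\ell\in[\tau]$, returns an $(s,z,\ell)$-temporal cut of size at most $2\log_2(2\ell)$ times the minimum size of an $(s,z,\ell)$-temporal cut of $G$.
   Context: For an integer $n$, $[n]=\{1,\dots,n\}$. A temporal graph $G=(V,E,\tau)$ has a vertex set $V$ and a set $E\subseteq V\times V\times[\tau]$ of temporal edges $(u,v,t)$; edges are undirected, i.e. $(u,v,t)\in E$ iff $(v,u,t)\in E$, and these two triples are regarded as the same edge (deleted together and counted once). A temporal path from $s$ to $z$ is a sequence of temporal edges $[(u_1,v_1,t_1),\dots,(u_h,v_h,t_h)]$ with $u_1=s$, $v_h=z$, $v_i=u_{i+1}$ and $t_i\le t_{i+1}$ for $i\in[h-1]$, the $u_i$ pairwise distinct and the $v_i$ pairwise distinct. Its travelling time is $t_h-t_1+1$. An $(s,z,\ell)$-temporal cut is a set $E'\subseteq E$ of temporal edges such that $G-E'$ contains no temporal path from $s$ to $z$ of travelling time at most $\ell$; the $(s,z,\ell)$-Temporal Cut problem asks for one of minimum size. *)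

(* Defs.v *)
From mathcomp Require Import all_boot all_order all_algebra.
From mathcomp Require Import reals exp.

Set Implicit Arguments.
Unset Strict Implicit.
Unset Printing Implicit Defensive.

Definition log2 (R : realType) (x : R) : R := (ln x / ln 2)%R.

(** * Temporal graphs *)

Section TemporalGraphs.
Variable V : finType.

(* Times are the values 1, ..., tau of 'I_tau.+1; the value 0 is excluded in
   the definition of temporal graphs. *)
Definition tedge (tau : nat) : finType := (V * V * 'I_tau.+1)%type.

Section Edges.
Variable tau : nat.
Implicit Types (e : tedge tau) (E F : {set tedge tau}).

Definition esrc e : V := e.1.1.
Definition edst e : V := e.1.2.
Definition etime e : nat := e.2.

Definition undirected E : Prop :=
  forall u v t, ((u, v, t) \in E) = ((v, u, t) \in E).

(* (u, v, t) and (v, u, t) are one edge and have the same image here. *)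
Definition num_edges E : nat :=
  #|[set ([set esrc e; edst e], e.2) | e in E]|.

(* A path is the nonempty sequence e :: p. *)
Definition temporal_path E (s z : V) e (p : seq (tedge tau)) : bool :=
  [&& all (mem E) (e :: p),
      esrc e == s, edst (last e p) == z,
      path (fun a b => (edst a == esrc b) && (etime a <= etime b)) e p,
      uniq (map esrc (e :: p)) & uniq (map edst (e :: p))].

Definition travelling_time e (p : seq (tedge tau)) : nat :=
  (etime (last e p) - etime e).+1.

End Edges.

Record temporal_graph := TemporalGraph {
  lifetime : nat;
  tedges : {set tedge lifetime};
  tedges_undirected : undirected tedges;
  tedges_time_gt0 : forall e, e \in tedges -> 0 < etime e
}.

(* Both orientations of an edge are deleted together, hence [undirected F]. *)
Definition is_temporal_cut (G : temporal_graph) (s z : V) (l : nat)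
    (F : {set tedge (lifetime G)}) : Prop :=
  [/\ F \subset tedges G, undirected F &
      ~ exists e p, temporal_path (tedges G :\: F) s z e p /\
                    travelling_time e p <= l].

End TemporalGraphs.

(** * Model of computation

  Jones' WHILE language: imperative programs over binary trees, with the usual
  time measure (one unit for each constructor, selector, variable access,
  assignment and test).  Trees can be shared, but a program can only inspect
  them through [hd], [tl] and emptiness tests, so that n steps are simulated on
  a heap of O(n) cells beyond the input; polynomial time is the same here as
  on Turing machines and on logarithmic-cost random access machines. *)

Inductive tree : Type := Leaf | Node of tree & tree.

Fixpoint tree_size (x : tree) : nat :=
  if x is Node a b then (tree_size a + tree_size b).+1 else 1.

Inductive expr : Type :=
  | EVar of nat
  | ELeaf
  | ENode of expr & expr
  | EHd of expr
  | ETl of expr.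

Inductive cmd : Type :=
  | CAssign of nat & expr
  | CSeq of cmd & cmd
  | CIf of expr & cmd & cmd
  | CWhile of expr & cmd.

Definition store : Type := nat -> tree.

Definition update (st : store) (i : nat) (x : tree) : store :=
  fun j => if j == i then x else st j.

Fixpoint eval (st : store) (e : expr) : tree :=
  match e with
  | EVar i => st i
  | ELeaf => Leaf
  | ENode a b => Node (eval st a) (eval st b)
  | EHd a => if eval st a is Node x _ then x else Leaf
  | ETl a => if eval st a is Node _ y then y else Leaf
  end.

Fixpoint expr_cost (e : expr) : nat :=
  match e with
  | EVar _ | ELeaf => 1
  | ENode a b => (expr_cost a + expr_cost b).+1
  | EHd a | ETl a => (expr_cost a).+1
  end.

(* [exec c st T st']: started in st, c halts in st' after exactly T units.
   In tests, Leaf is false and any Node is true. *)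
Inductive exec : cmd -> store -> nat -> store -> Prop :=
  | ExecAssign i e st :
      exec (CAssign i e) st (expr_cost e).+1 (update st i (eval st e))
  | ExecSeq c1 c2 st T1 st1 T2 st2 :
      exec c1 st T1 st1 -> exec c2 st1 T2 st2 ->
      exec (CSeq c1 c2) st (T1 + T2) st2
  | ExecIfTrue e c1 c2 st a b T st' :
      eval st e = Node a b -> exec c1 st T st' ->
      exec (CIf e c1 c2) st ((expr_cost e).+1 + T) st'
  | ExecIfFalse e c1 c2 st T st' :
      eval st e = Leaf -> exec c2 st T st' ->
      exec (CIf e c1 c2) st ((expr_cost e).+1 + T) st'
  | ExecWhileTrue e c st a b T1 st1 T2 st2 :
      eval st e = Node a b -> exec c st T1 st1 ->
      exec (CWhile e c) st1 T2 st2 ->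
      exec (CWhile e c) st ((expr_cost e).+1 + T1 + T2) st2
  | ExecWhileFalse e c st :
      eval st e = Leaf ->
      exec (CWhile e c) st (expr_cost e).+1 st.

(* Input and output are in variable 0; all other variables start as Leaf. *)
Definition computes_in (c : cmd) (x : tree) (T : nat) (y : tree) : Prop :=
  exists st, exec c (update (fun=> Leaf) 0 x) T st /\ st 0 = y.

(** * Encodings

  Natural numbers are written in binary, least significant bit first and
  without leading zeros, so the size of an encoding is linear in its bit
  length. *)

Definition enc_bool (b : bool) : tree := if b then Node Leaf Leaf else Leaf.

Fixpoint enc_pos (p : BinNums.positive) : tree :=
  match p with
  | BinNums.xH => Node (enc_bool true) Leaf
  | BinNums.xO q => Node (enc_bool false) (enc_pos q)
  | BinNums.xI q => Node (enc_bool true) (enc_pos q)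
  end.

Definition enc_nat (n : nat) : tree :=
  if bin_of_nat n is BinNums.Npos p then enc_pos p else Leaf.

Definition enc_seq (A : Type) (enc : A -> tree) (s : seq A) : tree :=
  foldr (fun a => Node (enc a)) Leaf s.

Definition enc_tedge n tau (e : tedge 'I_n tau) : tree :=
  Node (enc_nat (esrc e)) (Node (enc_nat (edst e)) (enc_nat (etime e))).

Definition enc_tedges n tau (es : seq (tedge 'I_n tau)) : tree :=
  enc_seq (@enc_tedge n tau) es.

Definition lists (T : finType) (xs : seq T) (A : {set T}) : Prop :=
  uniq xs /\ xs =i A.

(* The vertex set 'I_n is listed explicitly; es is meant to list the temporal
   edges, in an arbitrary order. *)
Definition enc_instance n tau (es : seq (tedge 'I_n tau)) (s z : 'I_n)
    (l : nat) : tree :=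
  Node (enc_seq enc_nat (iota 0 n))
    (Node (enc_nat tau)
      (Node (enc_tedges es)
        (Node (enc_nat s) (Node (enc_nat z) (enc_nat l))))).

(* Main.v *)
Require Import Defs.
From mathcomp Require Import all_boot all_order all_algebra.
From mathcomp Require Import boolp reals exp.
From mathcomp Require Import zify.

(** Deleting temporal edges is deleting vertices in the digraph whose vertices
  are the edges and whose arcs join an edge to an adjacent edge at the same time
  or later: short s-z paths become chains from an edge at s to an edge at z with
  times in a window [b, b + l).  For j = k, ..., 0, where k is the bit length of
  l, a minimum vertex separator of every window starting at a multiple of 2 ^ j
  is removed from what is left.  Level 0 destroys all short paths.  No level
  costs more than the optimum: an edge on chains of two windows of level j would
  allow their parts to be spliced into a chain of a window starting at a multiple
  of 2 ^ (j + 1), and those are gone; hence the parts of an optimal cut that lie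
  on chains of distinct windows are disjoint.  Finally
  k + 1 = floor (log2 l) + 2 <= 2 * log2 (2 * l).

  A minimum separator is read off a König cover of the bipartite graph with the
  edges not at z on the left and those not at s on the right.  The matching is
  found by an auction, in which an unmatched left vertex takes over a neighbour
  that received the fewest bids so far. *)

Set Implicit Arguments.
Unset Strict Implicit.
Unset Printing Implicit Defensive.

(** * Polynomial bounds *)

(** [n.+1] in place of n keeps the powers monotone in k even at n = 0. *)
Definition pol (K k n : nat) : nat := K * n.+1 ^ k.

Definition polyb (b : nat -> nat) : Prop :=
  exists K k, forall n, b n <= pol K k n.

Lemma leq_pol K k K' k' m n :
  K <= K' -> k <= k' -> m <= n -> pol K k m <= pol K' k' n.
Proof.
move=> leK lek lemn; apply: leq_mul => //.
apply: (@leq_trans (n.+1 ^ k)); last by rewrite leq_pexp2l.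
by case: k {lek} => // k; rewrite leq_exp2r.
Qed.

Lemma polyb_pol K k : polyb (pol K k).
Proof. by exists K, k. Qed.

Lemma polyb_const c : polyb (fun=> c).
Proof. by exists c, 0 => n; rewrite /pol expn0 muln1. Qed.

Lemma polyb_id : polyb id.
Proof. by exists 1, 1 => n; rewrite /pol expn1 mul1n. Qed.

Lemma polyb_add b b' : polyb b -> polyb b' -> polyb (fun n => b n + b' n).
Proof.
move=> [K [k H]] [K' [k' H']]; exists (K + K'), (maxn k k') => n.
rewrite /pol mulnDl; apply: leq_add.
- by apply: leq_trans (H n) _; rewrite -/(pol _ _ _) leq_pol ?leq_maxl.
- by apply: leq_trans (H' n) _; rewrite -/(pol _ _ _) leq_pol ?leq_maxr.
Qed.

Lemma polyb_mul b b' : polyb b -> polyb b' -> polyb (fun n => b n * b' n).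
Proof.
move=> [K [k H]] [K' [k' H']]; exists (K * K'), (k + k') => n.
by apply: leq_trans (leq_mul (H n) (H' n)) _; rewrite /pol expnD mulnACA.
Qed.

Lemma polyb_comp b b' : polyb b -> polyb b' -> polyb (fun n => b (b' n)).
Proof.
move=> [K [k H]] [K' [k' H']]; exists (K * K'.+1 ^ k), (k' * k) => n.
apply: leq_trans (H _) _; rewrite /pol expnM -mulnA -expnMn leq_mul //.
case: k {H} => // k; rewrite leq_exp2r // mulSn -[(b' n).+1]add1n leq_add //.
by rewrite expn_gt0.
Qed.

Ltac polyb_tac :=
  repeat first
    [ assumption | exact: polyb_const | exact: polyb_id | exact: polyb_pol
    | match goal with
      | |- polyb (fun n => pol ?K ?k (@?b n)) =>
          apply: (@polyb_comp (pol K k) b)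
      | |- polyb (fun n => S (@?b n)) => apply: (@polyb_add (fun=> 1) b)
      | |- polyb (fun n => @?b n + @?b' n) => apply: (@polyb_add b b')
      | |- polyb (fun n => @?b n * @?b' n) => apply: (@polyb_mul b b')
      end ].

(** * Polynomial-time programs *)

Class encodable (A : Type) := encode : A -> tree.
Arguments encode : simpl never.

#[export] Instance encodable_bool : encodable bool := enc_bool.
#[export] Instance encodable_nat : encodable nat := enc_nat.
#[export] Instance encodable_prod A B (ea : encodable A) (eb : encodable B) :
  encodable (A * B) := fun p => Node (encode p.1) (encode p.2).
#[export] Instance encodable_seq A (ea : encodable A) : encodable (seq A) :=
  enc_seq ea.

Notation esize a := (tree_size (encode a)).

(** Only variable 0 is prescribed at the start, so scratch variables may hold anything, and N bounds
    the variables that may change. Programs can thus be composed with saved values kept from N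
    on. *)
Definition computes (c : cmd) (N b : nat) (x y : tree) : Prop :=
  forall st, st 0 = x -> exists T st',
    [/\ exec c st T st', st' 0 = y, forall i, N <= i -> st' i = st i & T <= b].

(** The output size is bounded separately from the time: because of sharing, assigning
    [ENode (EVar 0) (EVar 0)] doubles a tree at constant cost. The size bound is what keeps
    compositions polynomial. *)
Definition ptime A B {ea : encodable A} {eb : encodable B} (f : A -> B) : Prop :=
  exists c N K k, forall a,
    computes c N (pol K k (esize a)) (encode a) (encode (f a)) /\
    esize (f a) <= pol K k (esize a).

Lemma ptime_intro A B {ea : encodable A} {eb : encodable B} (f : A -> B)
    c N b b' :
  polyb b -> polyb b' ->
  (forall a, computes c N (b (esize a)) (encode a) (encode (f a))) ->
  (forall a, esize (f a) <= b' (esize a)) -> ptime f.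
Proof.
move=> pb pb' Hc Hs; have [K [k H]] := polyb_add pb pb'.
exists c, N, K, k => a; split; last first.
  by apply: leq_trans (Hs a) (leq_trans (leq_addl _ _) (H _)).
move=> st /Hc [T [st' [E1 E2 E3 E4]]]; exists T, st'; split=> //.
exact: leq_trans E4 (leq_trans (leq_addr _ _) (H _)).
Qed.

Lemma eq_ptime A B {ea : encodable A} {eb : encodable B} (f g : A -> B) :
  f =1 g -> ptime f -> ptime g.
Proof.
by move=> fg [c [N [K [k H]]]]; exists c, N, K, k => a; rewrite -fg.
Qed.

Lemma updateE st i x j : update st i x j = if j == i then x else st j.
Proof. by []. Qed.

Lemma tree_size_gt0 x : 0 < tree_size x.
Proof. by case: x. Qed.

Lemma ptime_expr A B {ea : encodable A} {eb : encodable B} (f : A -> B) e b :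
  (forall a st, st 0 = encode a -> eval st e = encode (f a)) ->
  polyb b -> (forall a, esize (f a) <= b (esize a)) -> ptime f.
Proof.
move=> He pb Hb.
apply: (@ptime_intro _ _ _ _ _ (CAssign 0 e) 1 (fun=> (expr_cost e).+1) b) => //.
  exact: polyb_const.
move=> a st Hst; exists (expr_cost e).+1, (update st 0 (eval st e)); split=> //.
- exact: ExecAssign.
- by rewrite updateE eqxx (He a).
- by case.
Qed.

Lemma ptime_id A {ea : encodable A} : ptime (fun a : A => a).
Proof. by apply: (@ptime_expr _ _ _ _ _ (EVar 0) id) => //; exact: polyb_id. Qed.

Lemma ptime_comp A B C {ea : encodable A} {eb : encodable B} {ec : encodable C}
    (f : A -> B) (g : B -> C) :
  ptime f -> ptime g -> ptime (fun a => g (f a)).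
Proof.
move=> [c [N [K [k H]]]] [c' [N' [K' [k' H']]]].
pose b n := pol K k n + pol K' k' (pol K k n).
have pb : polyb b by rewrite /b; polyb_tac.
apply: (@ptime_intro _ _ _ _ _ (CSeq c c') (maxn N N') b b) => // a; last first.
  have [_ H1] := H a; have [_ H2] := H' (f a); apply: leq_trans H2 _.
  by apply: leq_trans (leq_addl _ _); rewrite leq_pol.
move=> st /(H a).1 [T [st1 [E1 E2 E3 E4]]].
have [T' [st2 [F1 F2 F3 F4]]] := (H' (f a)).1 st1 E2.
exists (T + T'), st2; split=> //.
- exact: ExecSeq E1 F1.
- by move=> i; rewrite geq_max => /andP[? ?]; rewrite F3 ?E3.
- apply: leq_add E4 (leq_trans F4 _); exact: leq_pol (H a).2.
Qed.

Lemma esize_nil A {ea : encodable A} : esize (@nil A) = 1.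
Proof. by []. Qed.

Lemma esize_cons A {ea : encodable A} (a : A) s :
  esize (a :: s) = (esize a + esize s).+1.
Proof. by []. Qed.

Lemma esize_pair A B {ea : encodable A} {eb : encodable B} (p : A * B) :
  esize p = (esize p.1 + esize p.2).+1.
Proof. by []. Qed.

Lemma ptime_pair A B C {ea : encodable A} {eb : encodable B} {ec : encodable C}
    (f : A -> B) (g : A -> C) :
  ptime f -> ptime g -> ptime (fun a => (f a, g a)).
Proof.
move=> [c [N [K [k H]]]] [c' [N' [K' [k' H']]]].
(* [M] and [M.+1] are beyond the reach of both programs; they keep the input and the first
   result. *)
pose M := (maxn N N').+1.
have leN : N <= M by rewrite ltnW // ltnS leq_maxl.
have leN' : N' <= M by rewrite ltnW // ltnS leq_maxr.
pose prog := CSeq (CAssign M (EVar 0)) (CSeq c (CSeq (CAssign M.+1 (EVar 0))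
  (CSeq (CAssign 0 (EVar M)) (CSeq c'
    (CAssign 0 (ENode (EVar M.+1) (EVar 0))))))).
pose b n := (pol K k n + pol K' k' n) + 10.
have pb : polyb b by rewrite /b; polyb_tac.
apply: (@ptime_intro _ _ _ _ _ prog M.+2 b b) => // a; last first.
  have [_ H1] := H a; have [_ H2] := H' a; rewrite /b esize_pair /=; lia.
move=> st Hst.
have [T [st1 [E1 E2 E3 E4]]] := (H a).1 (update st M (st 0)) Hst.
have E3M : st1 M = st 0 by rewrite E3 // updateE eqxx.
have [|T' [st2 [F1 F2 F3 F4]]] :=
  (H' a).1 (update (update st1 M.+1 (st1 0)) 0 (st 0)) _.
  by rewrite updateE eqxx.
exists (2 + (T + (2 + (2 + (T' + 4))))), (update st2 0 (Node (st2 M.+1) (st2 0))).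
split; last by rewrite /b; lia.
- apply: ExecSeq; first exact: ExecAssign.
  apply: ExecSeq; first exact: E1.
  apply: ExecSeq; first exact: ExecAssign.
  apply: ExecSeq; first exact: ExecAssign.
  apply: ExecSeq; last exact: ExecAssign.
  by rewrite /= updateE [M == _]ltn_eqF // E3M.
- rewrite updateE eqxx F2 F3; last by rewrite ltnW.
  by rewrite !updateE /= eqxx E2.
- move=> i lei; rewrite updateE (gtn_eqF (leq_ltn_trans _ lei)) //.
  rewrite F3; last by lia.
  by rewrite !updateE !gtn_eqF ?E3 ?updateE ?gtn_eqF //; lia.
Qed.

Lemma ptime_if A B {ea : encodable A} {eb : encodable B} (b : A -> bool)
    (f g : A -> B) :
  ptime b -> ptime f -> ptime g -> ptime (fun a => if b a then f a else g a).
Proof.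
move=> [c0 [N0 [K0 [k0 H0]]]] [c [N [K [k H]]]] [c' [N' [K' [k' H']]]].
pose M := (N0 + N + N').+1.
pose prog := CSeq (CAssign M (EVar 0)) (CSeq c0 (CSeq (CAssign M.+1 (EVar 0))
  (CSeq (CAssign 0 (EVar M)) (CIf (EVar M.+1) c c')))).
pose d n := (pol K0 k0 n + pol K k n + pol K' k' n) + 10.
have pd : polyb d by rewrite /d; polyb_tac.
apply: (@ptime_intro _ _ _ _ _ prog M.+2 d d) => // a; last first.
  have := (H a).2; have := (H' a).2; rewrite /d; case: ifP => _; lia.
move=> st Hst.
have [T [st1 [E1 E2 E3 E4]]] := (H0 a).1 (update st M (st 0)) Hst.
have E3M : st1 M = st 0 by rewrite E3 ?updateE ?eqxx //; lia.
pose st2 := update (update st1 M.+1 (st1 0)) 0 (st 0).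
have st2i i : M < i.-1 -> st2 i = st i.
  by move=> ?; rewrite /st2 !updateE !gtn_eqF ?E3 ?updateE ?gtn_eqF //; lia.
have st2M : st2 M.+1 = enc_bool (b a) by rewrite /st2 !updateE /= eqxx E2.
have pre T' st' : exec (CIf (EVar M.+1) c c') st2 T' st' ->
    exec prog st (2 + (T + (2 + (2 + T')))) st'.
  move=> ex; apply: ExecSeq; first exact: ExecAssign.
  apply: ExecSeq; first exact: E1.
  apply: ExecSeq; first exact: ExecAssign.
  apply: ExecSeq; first exact: ExecAssign.
  by rewrite /= updateE [M == _]ltn_eqF // E3M.
case bE: (b a); rewrite bE in st2M.
- have [T' [st' [F1 F2 F3 F4]]] := (H a).1 st2 Hst.
  exists (2 + (T + (2 + (2 + (2 + T'))))), st'; split=> //.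
  + by apply: pre; apply: ExecIfTrue F1; exact: st2M.
  + by move=> i lei; rewrite F3 ?st2i //; lia.
  + rewrite /d; lia.
- have [T' [st' [F1 F2 F3 F4]]] := (H' a).1 st2 Hst.
  exists (2 + (T + (2 + (2 + (2 + T'))))), st'; split=> //.
  + by apply: pre; apply: ExecIfFalse F1; exact: st2M.
  + by move=> i lei; rewrite F3 ?st2i //; lia.
  + rewrite /d; lia.
Qed.

Fixpoint quote (x : tree) : expr :=
  if x is Node a b then ENode (quote a) (quote b) else ELeaf.

Lemma eval_quote st x : eval st (quote x) = x.
Proof. by elim: x => //= a -> b ->. Qed.

Lemma ptime_const A B {ea : encodable A} {eb : encodable B} (b : B) :
  ptime (fun _ : A => b).
Proof.
apply: (@ptime_expr _ _ _ _ _ (quote (encode b)) (fun=> esize b)) => //.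
  by move=> a st _; rewrite eval_quote.
exact: polyb_const.
Qed.

Section Combinators.
Context {X A B : Type} {ex : encodable X} {ea : encodable A} {eb : encodable B}.

Lemma ptime_fst (f : X -> A * B) : ptime f -> ptime (fun x => (f x).1).
Proof.
move=> pf; apply: ptime_comp pf _.
apply: (@ptime_expr _ _ _ _ _ (EHd (EVar 0)) id).
- by move=> [a b] st /= ->.
- exact: polyb_id.
- by move=> [a b]; rewrite esize_pair /=; lia.
Qed.

Lemma ptime_snd (f : X -> A * B) : ptime f -> ptime (fun x => (f x).2).
Proof.
move=> pf; apply: ptime_comp pf _.
apply: (@ptime_expr _ _ _ _ _ (ETl (EVar 0)) id).
- by move=> [a b] st /= ->.
- exact: polyb_id.
- by move=> [a b]; rewrite esize_pair /=; lia.
Qed.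

Lemma ptime_cons (f : X -> A) (g : X -> seq A) :
  ptime f -> ptime g -> ptime (fun x => f x :: g x).
Proof.
move=> pf pg; apply: (ptime_comp (ptime_pair pf pg) (g := fun p => p.1 :: p.2)).
by apply: (@ptime_expr _ _ _ _ _ (EVar 0) id) => //; exact: polyb_id.
Qed.

Lemma ptime_behead (f : X -> seq A) : ptime f -> ptime (fun x => behead (f x)).
Proof.
move=> pf; apply: ptime_comp pf _.
apply: (@ptime_expr _ _ _ _ _ (ETl (EVar 0)) id).
- by move=> [|a s] st /= ->.
- exact: polyb_id.
- by case=> // a s; rewrite esize_cons /=; lia.
Qed.

Lemma ptime_head a0 (f : X -> seq A) : ptime f -> ptime (fun x => head a0 (f x)).
Proof.
move=> pf; apply: ptime_comp pf _.
pose d n := n + tree_size (ea a0) + expr_cost (quote (ea a0)) + 10.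
have pd : polyb d by rewrite /d; polyb_tac.
pose c := CIf (EVar 0) (CAssign 0 (EHd (EVar 0))) (CAssign 0 (quote (ea a0))).
apply: (@ptime_intro _ _ _ _ _ c 1 d d) => // -[|a s] => [st st0|st st0||].
- exists (2 + (expr_cost (quote (ea a0))).+1), (update st 0 (ea a0)).
  split; [|by [] |by case|by rewrite /d; lia].
  apply: ExecIfFalse => //; have := ExecAssign 0 (quote (ea a0)) st.
  by rewrite eval_quote.
- exists (2 + 3), (update st 0 (encode a)).
  split; [|by [] |by case|by rewrite /d; lia].
  apply: (@ExecIfTrue _ _ _ _ (encode a) (encode s)); first exact: st0.
  have -> : encode a = eval st (EHd (EVar 0)) by rewrite /= st0.
  exact: ExecAssign.
- by rewrite /d /= -[tree_size (encode a0)]/(tree_size (ea a0)); lia.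
- by rewrite /d [head _ _]/= esize_cons; lia.
Qed.

Lemma ptime_nilp (f : X -> seq A) : ptime f -> ptime (fun x => nilp (f x)).
Proof.
move=> pf; apply: ptime_comp pf _.
pose c := CIf (EVar 0) (CAssign 0 ELeaf) (CAssign 0 (ENode ELeaf ELeaf)).
apply: (@ptime_intro _ _ _ _ _ c 1 (fun=> 10) (fun=> 10));
  try exact: polyb_const; last by move=> a; case: nilp.
move=> [|a s] st st0.
- exists (2 + 4), (update st 0 (Node Leaf Leaf)).
  split; [|by [] |by case|by []].
  by apply: ExecIfFalse => //; exact: ExecAssign.
- exists (2 + 2), (update st 0 Leaf).
  split; [|by [] |by case|by []].
  apply: (@ExecIfTrue _ _ _ _ (encode a) (encode s)); first exact: st0.
  exact: ExecAssign.
Qed.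

End Combinators.

Lemma esize_cat A {ea : encodable A} (s t : seq A) :
  esize (s ++ t) + 1 = esize s + esize t.
Proof.
elim: s => [|a s IH]; first by rewrite esize_nil addnC.
by rewrite cat_cons !esize_cons; lia.
Qed.

Lemma size_le_esize A {ea : encodable A} (s : seq A) : size s < esize s.
Proof.
elim: s => [|a s IH]; first by rewrite esize_nil.
by rewrite esize_cons /=; lia.
Qed.

(** * Loops over lists *)

Section Fold.
Context {X A B : Type} {ex : encodable X} {ea : encodable A} {eb : encodable B}.
Variables (f : X -> B -> A -> B) (b0 : X -> B) (s : X -> seq A) (q : nat -> nat).
Hypothesis pf : ptime (fun p : X * (B * A) => f p.1 p.2.1 p.2.2).
Hypothesis pb0 : ptime b0.
Hypothesis ps : ptime s.
Hypothesis pq : polyb q.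
Hypothesis qP : forall x u v,
  s x = u ++ v -> esize (foldl (f x) (b0 x) u) <= q (esize x).

(** A polynomial-time step might still square the accumulator in every round; hence the bound [qP]
    on all its intermediate values, under which each round has polynomial cost. *)
Lemma ptime_foldl : ptime (fun x => foldl (f x) (b0 x) (s x)).
Proof.
have [cf [Nf [Kf [kf Hf]]]] := pf.
have [cb [Nb [Kb [kb Hb]]]] := pb0.
have [cs [Ns [Ks [ks Hs]]]] := ps.
(* [M] keeps the input, [M.+1] the rest of the list and [M.+2] the accumulator. *)
pose M := (Nf + Nb + Ns).+1.
pose arg := ENode (EVar M) (ENode (EVar M.+2) (EHd (EVar M.+1))).
pose body := CSeq (CAssign 0 arg) (CSeq cf
  (CSeq (CAssign M.+2 (EVar 0)) (CAssign M.+1 (ETl (EVar M.+1))))).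
pose loop := CWhile (EVar M.+1) body.
pose prog := CSeq (CAssign M (EVar 0)) (CSeq cs (CSeq (CAssign M.+1 (EVar 0))
  (CSeq (CAssign 0 (EVar M)) (CSeq cb (CSeq (CAssign M.+2 (EVar 0))
  (CSeq loop (CAssign 0 (EVar M.+2)))))))).
(* Cost of a round: 14 units for the test and the assignments, and one call of the step on (x, (b,
   a)), whose size is at most the argument of [pol]. *)
pose D n := 14 + pol Kf kf (n + q n + pol Ks ks n + 2).
pose d n := pol Ks ks n * D n + pol Kb kb n + pol Ks ks n + 20.
have pd : polyb d.
  rewrite /d /D; apply: polyb_add; last exact: polyb_const.
  apply: polyb_add; last exact: polyb_pol.
  apply: polyb_add; last exact: polyb_pol.
  apply: polyb_mul; first exact: polyb_pol.
  apply: polyb_add; first exact: polyb_const.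
  apply: (polyb_comp (polyb_pol Kf kf)).
  apply: polyb_add; last exact: polyb_const.
  apply: polyb_add; last exact: polyb_pol.
  by apply: polyb_add => //; exact: polyb_id.
apply: (@ptime_intro _ _ _ _ _ prog M.+3 d q) => // [x|x]; last first.
  by apply: (@qP _ _ [::]); rewrite cats0.
have loopP v : forall u st, s x = u ++ v -> st M = encode x ->
    st M.+1 = encode v -> st M.+2 = encode (foldl (f x) (b0 x) u) ->
    exists T st', [/\ exec loop st T st',
      st' M.+2 = encode (foldl (f x) (b0 x) (s x)),
      forall i, M.+3 <= i -> st' i = st i & T <= 2 + size v * D (esize x)].
  elim: v => [|a v IH] u st sE stM stM1 stM2.
    exists 2, st; split=> //; first exact: ExecWhileFalse.
    by rewrite stM2 sE cats0.
  set b := foldl _ _ _ in stM2.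
  have [|T1 [st1 [E1 E2 E3 E4]]] := (Hf (x, (b, a))).1
     (update st 0 (encode (x, (b, a)))) _; first by rewrite updateE eqxx.
  pose st2 := update (update st1 M.+2 (st1 0)) M.+1 (enc_seq ea v).
  have st2i i : M.+2 < i -> st2 i = st i.
    by move=> ?; rewrite /st2 !updateE !gtn_eqF ?E3 ?updateE ?gtn_eqF //; lia.
  have [||||T2 [st3 [F1 F2 F3 F4]]] := IH (rcons u a) st2.
  - by rewrite sE cat_rcons.
  - rewrite /st2 !updateE [M == _]ltn_eqF // [M == _]ltn_eqF //.
    by rewrite E3 ?updateE //; lia.
  - by rewrite /st2 updateE eqxx.
  - rewrite /st2 !updateE eqxx [_ == M.+1]gtn_eqF // E2 /=.
    by rewrite -cats1 foldl_cat.
  exists (2 + (7 + (T1 + (2 + 3))) + T2), st3; split=> //.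
  - refine (@ExecWhileTrue (EVar M.+1) body st (ea a) (enc_seq ea v)
      (7 + (T1 + (2 + 3))) st2 T2 st3 stM1 _ F1).
    apply: ExecSeq.
      have := ExecAssign 0 arg st.
      rewrite /= stM stM1 stM2; exact.
    apply: ExecSeq; first exact: E1.
    apply: ExecSeq; first exact: ExecAssign.
    have := ExecAssign M.+1 (ETl (EVar M.+1)) (update st1 M.+2 (st1 0)).
    rewrite /= updateE [M.+1 == _]ltn_eqF // [st1 M.+1]E3; last by lia.
    by rewrite updateE /= stM1.
  - by move=> i lei; rewrite F3 // st2i.
  - rewrite [size _]/= mulSn; have D_ge : T1 + 14 <= D (esize x); last by lia.
    rewrite addnC leq_add2l; apply: leq_trans E4 _; apply: leq_pol => //.
    have := (Hs x).2; have := qP sE; rewrite -/b !esize_pair /= sE.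
    have := @esize_cat A ea u (a :: v); rewrite esize_cons.
    by have := tree_size_gt0 (encode u); lia.
move=> st st0.
have [T1 [st1 [E1 E2 E3 E4]]] := (Hs x).1 (update st M (st 0)) st0.
have st1M : st1 M = encode x by rewrite E3 ?updateE ?eqxx //; lia.
pose st2 := update (update st1 M.+1 (enc_seq ea (s x))) 0 (ex x).
have [|T2 [st3 [F1 F2 F3 F4]]] := (Hb x).1 st2 _.
  by rewrite /st2 updateE eqxx.
pose st4 := update st3 M.+2 (st3 0).
have [||||T3 [st5 [G1 G2 G3 G4]]] := loopP (s x) [::] st4.
- by [].
- rewrite /st4 updateE [M == _]ltn_eqF // F3; last by lia.
  by rewrite /st2 !updateE [M == M.+1]ltn_eqF.
- rewrite /st4 updateE [_ == M.+2]ltn_eqF // F3; last by lia.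
  by rewrite /st2 !updateE eqxx.
- by rewrite /st4 updateE eqxx F2.
exists (2 + (T1 + (2 + (2 + (T2 + (2 + (T3 + 2))))))), (update st5 0 (st5 M.+2)).
split.
- apply: ExecSeq; first exact: ExecAssign.
  apply: ExecSeq; first exact: E1.
  apply: ExecSeq; first exact: ExecAssign.
  apply: ExecSeq; first exact: ExecAssign.
  rewrite /= E2 updateE [M == _]ltn_eqF // st1M.
  apply: ExecSeq; first exact: F1.
  apply: ExecSeq; first exact: ExecAssign.
  by apply: ExecSeq; [exact: G1 | exact: ExecAssign].
- by rewrite updateE eqxx.
- move=> i lei; rewrite updateE [i == 0]gtn_eqF; last by lia.
  rewrite G3 // /st4 updateE [i == _]gtn_eqF // F3; last by lia.
  rewrite /st2 !updateE ?[i == _]gtn_eqF; [|lia..].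
  rewrite E3; last by lia.
  by rewrite updateE gtn_eqF //; lia.
- apply: (@leq_trans (T1 + T2 + size (s x) * D (tree_size (encode x)) + 20)).
    by lia.
  rewrite leq_add2r.
  have : size (s x) * D (esize x) <= pol Ks ks (esize x) * D (esize x).
    rewrite leq_mul2r; apply/orP; right; apply: leq_trans (Hs x).2.
    by rewrite ltnW // size_le_esize.
  by lia.
Qed.

End Fold.

Section FoldAdditive.
Context {X A B : Type} {ex : encodable X} {ea : encodable A} {eb : encodable B}.
Variables (f : X -> B -> A -> B) (b0 : X -> B) (s : X -> seq A) (q : nat -> nat).

(** When the growth in a round does not depend on the accumulator, the growths merely add up over
    the list, which gives the bound required by [ptime_foldl]. *)
Lemma ptime_foldl_add :
  ptime (fun p : X * (B * A) => f p.1 p.2.1 p.2.2) -> ptime b0 -> ptime s ->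
  polyb q ->
  (forall x b a, esize (f x b a) <= esize b + q (esize x + esize a)) ->
  ptime (fun x => foldl (f x) (b0 x) (s x)).
Proof.
move=> pf pb0 ps [K [k qP]] fP.
have [cb [Nb [Kb [kb Hb]]]] := pb0; have [cs [Ns [Ks [ks Hs]]]] := ps.
pose Q n := pol Kb kb n + pol Ks ks n * pol K k (n + pol Ks ks n).
apply: (@ptime_foldl _ _ _ _ _ _ _ _ _ Q) => //.
  rewrite /Q; apply: polyb_add; [exact: polyb_pol|apply: polyb_mul].
    exact: polyb_pol.
  apply: (polyb_comp (polyb_pol K k)).
  by apply: polyb_add; [exact: polyb_id|exact: polyb_pol].
move=> x u v sE; have Hbx := (Hb x).2; have Hsx := (Hs x).2; rewrite /Q.
have Eu := @esize_cat A ea u v; rewrite -sE in Eu.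
have v0 : 0 < esize v by exact: tree_size_gt0.
have foldP w : forall b, esize w <= pol Ks ks (esize x) ->
    esize (foldl (f x) b w) <=
    esize b + size w * pol K k (esize x + pol Ks ks (esize x)).
  elim: w => [|a w IH] b; first by rewrite [foldl _ _ _]/=; lia.
  rewrite esize_cons => lew; apply: leq_trans (IH _ _) _; first by lia.
  rewrite [size (a :: w)]/= mulSn.
  have: esize (f x b a) <= esize b + pol K k (esize x + pol Ks ks (esize x));
    last by lia.
  apply: leq_trans (fP x b a) _; rewrite leq_add2l; apply: leq_trans (qP _) _.
  by apply: leq_pol => //; lia.
apply: leq_trans (foldP _ _ _) _; first by lia.
apply: leq_add => //; rewrite leq_mul2r; apply/orP; right.
by have := @size_le_esize A ea u; lia.
Qed.

End FoldAdditive.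

Section Booleans.
Context {X B : Type} {ex : encodable X} {eb : encodable B}.

Lemma ptime_neg (f : X -> bool) : ptime f -> ptime (fun x => ~~ f x).
Proof.
move=> pf; apply: (ptime_if pf); exact: ptime_const.
Qed.

Lemma ptime_and (f g : X -> bool) :
  ptime f -> ptime g -> ptime (fun x => f x && g x).
Proof.
move=> pf pg; apply: (ptime_if pf pg); exact: ptime_const.
Qed.

Lemma ptime_or (f g : X -> bool) :
  ptime f -> ptime g -> ptime (fun x => f x || g x).
Proof.
move=> pf pg; apply: (ptime_if pf _ pg); exact: ptime_const.
Qed.

(** Replaces a Boolean argument by its two values, so that a function of finitely many bits reduces
    to constant functions. *)
Lemma ptime_bool_case (F : bool -> X -> B) (b : X -> bool) :
  ptime b -> ptime (F true) -> ptime (F false) -> ptime (fun x => F (b x) x).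
Proof.
move=> pb pt pf; apply: eq_ptime (ptime_if pb pt pf) => x.
by case: (b x).
Qed.

End Booleans.

Section Lists.
Context {X A B : Type} {ex : encodable X} {ea : encodable A} {eb : encodable B}.

Lemma ptime_has (P : X -> pred A) (s : X -> seq A) :
  ptime (fun p : X * A => P p.1 p.2) -> ptime s ->
  ptime (fun x => has (P x) (s x)).
Proof.
move=> pP ps.
apply: (@eq_ptime _ _ _ _ (fun x => foldl (fun b a => b || P x a) false (s x))).
  move=> x; rewrite -[has _ _]/(false || has _ _).
  elim: (s x) false => [|a t IH] b /=; first by rewrite orbF.
  by rewrite IH orbA.
apply: (@ptime_foldl_add _ _ _ _ _ _ _ _ _ (fun=> 3)) => //.
- apply: ptime_or; first exact: (ptime_fst (ptime_snd (ptime_id))).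
  apply: (ptime_comp (ptime_pair (ptime_fst (ptime_id))
    (ptime_snd (ptime_snd (ptime_id)))) pP).
- exact: ptime_const.
- exact: polyb_const.
- move=> x b a; case: (b || P x a); last by rewrite /encode /=; lia.
  by rewrite /encode /=; lia.
Qed.

Lemma ptime_catrev (f g : X -> seq A) :
  ptime f -> ptime g -> ptime (fun x => catrev (f x) (g x)).
Proof.
move=> pf pg.
apply: (@eq_ptime _ _ _ _ (fun x => foldl (fun b a => a :: b) (g x) (f x))).
  by move=> x; elim: (f x) (g x) => //= a s IH t; rewrite IH.
apply: (@ptime_foldl_add _ _ _ _ _ _ _ _ _ (fun n => n + 1)) => //.
- apply: ptime_cons; first exact: (ptime_snd (ptime_snd (ptime_id))).
  exact: (ptime_fst (ptime_snd (ptime_id))).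
- exact: (polyb_add polyb_id (polyb_const _)).
- by move=> x b a; rewrite esize_cons; lia.
Qed.

Lemma ptime_rev (f : X -> seq A) : ptime f -> ptime (fun x => rev (f x)).
Proof. by move=> pf; apply: ptime_catrev pf _; exact: ptime_const. Qed.

Lemma ptime_cat (f g : X -> seq A) :
  ptime f -> ptime g -> ptime (fun x => f x ++ g x).
Proof.
move=> pf pg; apply: eq_ptime (ptime_catrev (ptime_rev pf) pg) => x.
by rewrite catrevE revK.
Qed.

Lemma ptime_filter (P : X -> pred A) (s : X -> seq A) :
  ptime (fun p : X * A => P p.1 p.2) -> ptime s ->
  ptime (fun x => filter (P x) (s x)).
Proof.
move=> pP ps.
apply: (@eq_ptime _ _ _ _
  (fun x => rev (foldl (fun b a => if P x a then a :: b else b) [::] (s x)))).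
  move=> x; rewrite -[RHS]revK; congr rev; rewrite -[RHS]cats0.
  elim: (s x) [::] => //= a t IH b; rewrite IH.
  by case: ifP => // _; rewrite rev_cons cat_rcons.
apply: ptime_rev; apply: (@ptime_foldl_add _ _ _ _ _ _ _ _ _ (fun n => n + 1)) => //.
- apply: ptime_if.
  + apply: (ptime_comp (ptime_pair (ptime_fst (ptime_id))
      (ptime_snd (ptime_snd (ptime_id)))) pP).
  + apply: ptime_cons; first exact: (ptime_snd (ptime_snd (ptime_id))).
    exact: (ptime_fst (ptime_snd (ptime_id))).
  + exact: (ptime_fst (ptime_snd (ptime_id))).
- exact: ptime_const.
- exact: (polyb_add polyb_id (polyb_const _)).
- by move=> x b a; case: ifP => _; rewrite ?esize_cons; lia.
Qed.

End Lists.

Lemma ptime_flatmap X A B {ex : encodable X} {ea : encodable A}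
    {eb : encodable B} (h : X -> A -> seq B) (s : X -> seq A) :
  ptime (fun p : X * A => h p.1 p.2) -> ptime s ->
  ptime (fun x => flatten (map (h x) (s x))).
Proof.
move=> ph ps.
apply: (@eq_ptime _ _ _ _ (fun x => foldl (fun b a => b ++ h x a) [::] (s x))).
  move=> x; rewrite -[RHS]cat0s.
  elim: (s x) [::] => [|a t IH] b /=; first by rewrite cats0.
  by rewrite IH catA.
have [c [N [K [k H]]]] := ph.
apply: (@ptime_foldl_add _ _ _ _ _ _ _ _ _ (fun n => pol K k (n + 1))) => //.
- apply: ptime_cat; first exact: (ptime_fst (ptime_snd (ptime_id))).
  apply: (ptime_comp (ptime_pair (ptime_fst (ptime_id))
    (ptime_snd (ptime_snd (ptime_id)))) ph).
- exact: ptime_const.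
- exact: (polyb_comp (polyb_pol _ _) (polyb_add polyb_id (polyb_const _))).
- move=> x b a; have H1 := (H (x, a)).2; rewrite esize_pair /= in H1.
  by rewrite addn1; have := @esize_cat B eb b (h x a); lia.
Qed.

Lemma ptime_map X A B {ex : encodable X} {ea : encodable A}
    {eb : encodable B} (h : X -> A -> B) (s : X -> seq A) :
  ptime (fun p : X * A => h p.1 p.2) -> ptime s ->
  ptime (fun x => map (h x) (s x)).
Proof.
move=> ph ps.
apply: (@eq_ptime _ _ _ _ (fun x => flatten [seq [:: h x a] | a <- s x])).
  by move=> x; elim: (s x) => //= a t ->.
apply: (@ptime_flatmap _ _ _ _ _ _ (fun x a => [:: h x a])) => //.
by apply: ptime_cons => //; exact: ptime_const.
Qed.

(** A hook, redefined below, through which later closure lemmas join [ptime_tac]. *)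
Ltac ptime_ext := fail.
Ltac ptime_step :=
  cbn beta iota delta [Equality.sort Datatypes_prod__canonical__eqtype_Equality
    Datatypes_nat__canonical__eqtype_Equality];
  lazymatch goal with
  | |- ptime (fun _ => ?c) => exact: ptime_const
  | |- ptime (fun x => x) => exact: ptime_id
  | |- ptime (fun x => (@?f x, @?g x)) => apply: (@ptime_pair _ _ _ _ _ _ f g)
  | |- ptime (fun x => fst (@?f x)) => apply: (@ptime_fst _ _ _ _ _ _ f)
  | |- ptime (fun x => snd (@?f x)) => apply: (@ptime_snd _ _ _ _ _ _ f)
  | |- ptime (fun x => negb (@?f x)) => apply: (@ptime_neg _ _ f)
  | |- ptime (fun x => andb (@?f x) (@?g x)) => apply: (@ptime_and _ _ f g)
  | |- ptime (fun x => orb (@?f x) (@?g x)) => apply: (@ptime_or _ _ f g)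
  | |- ptime (fun x => if _ then _ else _) => apply: ptime_if
  | |- ptime (fun x => cons (@?f x) (@?g x)) => apply: (@ptime_cons _ _ _ _ f g)
  | |- ptime (fun x => behead (@?f x)) => apply: (@ptime_behead _ _ _ _ f)
  | |- ptime (fun x => nilp (@?f x)) => apply: (@ptime_nilp _ _ _ _ f)
  | |- ptime (fun x => rev (@?f x)) => apply: (@ptime_rev _ _ _ _ f)
  | |- ptime (fun x => cat (@?f x) (@?g x)) => apply: (@ptime_cat _ _ _ _ f g)
  | |- ptime (fun x => head ?a (@?f x)) => apply: (@ptime_head _ _ _ _ a f)
  | |- ptime (fun x => has (@?P x) (@?f x)) => apply: (@ptime_has _ _ _ _ P f)
  | |- ptime (fun x => flatten (map (@?h x) (@?f x))) =>
      apply: (@ptime_flatmap _ _ _ _ _ _ h f)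
  | |- ptime (fun x => map (@?h x) (@?f x)) =>
      apply: (@ptime_map _ _ _ _ _ _ h f)
  | |- ptime (fun x => filter (@?P x) (@?f x)) =>
      apply: (@ptime_filter _ _ _ _ P f)
  | |- _ => first [assumption | ptime_ext]
  end.
Ltac ptime_tac := repeat ptime_step.

(** List lengths serve as unary numbers: there is one [behead] for each entry of [f x]. *)
Lemma ptime_drop X A B {ex : encodable X} {ea : encodable A} {eb : encodable B}
    (f : X -> seq A) (g : X -> seq B) :
  ptime f -> ptime g -> ptime (fun x => drop (size (f x)) (g x)).
Proof.
move=> pf pg.
apply: (@eq_ptime _ _ _ _ (fun x => foldl (fun r _ => behead r) (g x) (f x))).
  move=> x; elim: (f x) (g x) => [|a s IH] t /=; first by rewrite drop0.
  by rewrite IH; case: t.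
apply: (@ptime_foldl_add _ _ _ _ _ _ _ _ _ (fun=> 0)); [by ptime_tac..| |].
  exact: polyb_const.
by move=> x [|b s] a; rewrite ?esize_cons [behead _]/=; lia.
Qed.

Lemma ptime_size_le X A B {ex : encodable X} {ea : encodable A}
    {eb : encodable B} (f : X -> seq A) (g : X -> seq B) :
  ptime f -> ptime g -> ptime (fun x => size (f x) <= size (g x)).
Proof.
move=> pf pg; apply: eq_ptime (ptime_nilp (ptime_drop pg pf)) => x.
by rewrite /nilp size_drop subn_eq0.
Qed.

(** * Binary arithmetic *)

Fixpoint bits_pos (p : BinNums.positive) : seq bool :=
  match p with
  | BinNums.xH => [:: true]
  | BinNums.xO q => false :: bits_pos q
  | BinNums.xI q => true :: bits_pos q
  end.

Definition bits (n : nat) : seq bool :=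
  if bin_of_nat n is BinNums.Npos p then bits_pos p else [::].

Definition bits_val (s : seq bool) : nat :=
  foldr (fun (b : bool) v => b + v.*2) 0 s.

(** A number and its bit list are the same tree, so passing from one to the other takes no
    computation. *)
Lemma encode_bits n : encode (bits n) = encode n.
Proof.
rewrite /encode /encodable_nat /encodable_seq /bits /enc_nat.
by case: (bin_of_nat n) => // p; elim: p => //= p ->.
Qed.

Lemma bitsK : cancel bits bits_val.
Proof.
move=> n; rewrite -[RHS]bin_of_natK /bits; case: (bin_of_nat n) => // p.
by elim: p => //= p ->; rewrite -?doubleE NatTrec.doubleE.
Qed.

Lemma ptime_bits X {ex : encodable X} (f : X -> nat) :
  ptime f -> ptime (fun x => bits (f x)).
Proof.
move=> pf; apply: (ptime_comp pf (g := bits)).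
apply: (@ptime_expr _ _ _ _ _ (EVar 0) id); last by move=> n; rewrite encode_bits.
  by move=> n st /= ->; rewrite encode_bits.
exact: polyb_id.
Qed.

(* The carry [c.1 + c.2] is one more than the floor of
   (y + z - x - 1) / 2 ^ i, where x, y, z are restricted to their first i bits. *)
Definition lt_add_carry (b1 b2 x y z : bool) : bool * bool :=
  let k := b1 + b2 + y + z + ~~ x in (2 <= k, 4 <= k).

Local Notation lt_add_state :=
  (bool * bool * (seq bool * (seq bool * seq bool)))%type.

Definition lt_add_step (st : lt_add_state) : lt_add_state :=
  let: (b, (x, (y, z))) := st in
  (lt_add_carry b.1 b.2 (head false x) (head false y) (head false z),
   (behead x, (behead y, behead z))).

Lemma bits_val_head s : bits_val s = head false s + (bits_val (behead s)).*2.
Proof. by case: s. Qed.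

(** The carry 0, 1 or 2 is written in unary by two bits, hence [b.2 -> b.1]. Each step halves the
    inequality; once all bits are consumed it says that the carry is positive. *)
Lemma lt_add_stepP n : forall (b : bool * bool) (x y z : seq bool),
  size x <= n -> size y <= n -> size z <= n -> (b.2 -> b.1) ->
  (iter n lt_add_step (b, (x, (y, z)))).1.1 =
  (bits_val x < b.1 + b.2 + bits_val y + bits_val z).
Proof.
elim: n => [|n IH] b x y z.
  rewrite !leqn0 !size_eq0 => /eqP-> /eqP-> /eqP->.
  by case: b => [[] []] // /(_ isT).
move=> lex ley lez b21; rewrite iterSr /= IH; last first.
- by case: b b21 => [[] []] /=; do 3![case: (head _ _)].
- by case: z lez.
- by case: y ley.
- by case: x lex.
rewrite (bits_val_head x) (bits_val_head y) (bits_val_head z).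
move: (bits_val _) (bits_val _) (bits_val _) => vx vy vz.
by case: b b21 => [[] []] /= b21; do 3![case: (head _ _)];
  rewrite /=; first [have := b21 isT; done | lia].
Qed.

Lemma ptime_lt_add_carry X {ex : encodable X} (b1 b2 x y z : X -> bool) :
  ptime b1 -> ptime b2 -> ptime x -> ptime y -> ptime z ->
  ptime (fun a => lt_add_carry (b1 a) (b2 a) (x a) (y a) (z a)).
Proof.
move=> p1 p2 px py pz.
apply: (@ptime_bool_case _ _ _ _
  (fun c a => lt_add_carry c (b2 a) (x a) (y a) (z a)) b1 p1).
all: apply: (@ptime_bool_case _ _ _ _
  (fun c a => lt_add_carry _ c (x a) (y a) (z a)) b2 p2).
all: apply: (@ptime_bool_case _ _ _ _
  (fun c a => lt_add_carry _ _ c (y a) (z a)) x px).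
all: apply: (@ptime_bool_case _ _ _ _
  (fun c a => lt_add_carry _ _ _ c (z a)) y py).
all: apply: (@ptime_bool_case _ _ _ _ (fun c a => lt_add_carry _ _ _ _ c) z pz).
all: exact: ptime_const.
Qed.

Lemma ptime_lt_add X {ex : encodable X} (f g h : X -> seq bool) :
  ptime f -> ptime g -> ptime h ->
  ptime (fun x => bits_val (f x) < bits_val (g x) + bits_val (h x)).
Proof.
move=> pf pg ph.
(* The list [f x ++ g x ++ h x] only counts rounds; it is long enough to consume all three
   numbers. *)
apply: (@eq_ptime _ _ _ _ (fun x => (foldl (fun st (_ : bool) => lt_add_step st)
   (false, false, (f x, (g x, h x))) (f x ++ g x ++ h x)).1.1)).
  move=> x; have -> (st : lt_add_state) (s : seq bool) :
      foldl (fun st _ => lt_add_step st) st s = iter (size s) lt_add_step st.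
    by elim: s st => // b s IH st; rewrite [size _]/= iterSr -IH.
  by rewrite lt_add_stepP ?size_cat; try lia.
apply/ptime_fst/ptime_fst; apply: (@ptime_foldl_add _ _ _ _ _ _ _ _ _ (fun=> 10)).
- apply: (@eq_ptime _ _ _ _ (fun p : X * (lt_add_state * bool) =>
    let st := p.2.1 in
    (lt_add_carry st.1.1 st.1.2 (head false st.2.1) (head false st.2.2.1)
       (head false st.2.2.2),
    (behead st.2.1, (behead st.2.2.1, behead st.2.2.2))))).
    by move=> [x [[b [u [v w]]] c]].
  cbv zeta; apply: ptime_pair; last by ptime_tac.
  by apply: ptime_lt_add_carry; ptime_tac.
- by ptime_tac.
- by ptime_tac.
- exact: polyb_const.
- move=> x [[b1 b2] [u [v w]]] _.
  have leb (s : seq bool) : esize (behead s) <= esize s.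
    by case: s => // b s; rewrite esize_cons [behead _]/=; lia.
  have lec (b : bool) : esize b <= 3 by case: b.
  rewrite [lt_add_step _]/=; case: (lt_add_carry _ _ _ _ _) => c1 c2.
  rewrite !esize_pair [X in X <= _]/= [in X in _ <= X]/=.
  have := leb u; have := leb v; have := leb w; have := lec c1; have := lec c2.
  lia.
Qed.

Section NatComparison.
Context {X : Type} {ex : encodable X}.

Lemma ptime_leq (f g : X -> nat) :
  ptime f -> ptime g -> ptime (fun x => f x <= g x).
Proof.
(* [[:: true]] is the number 1, which turns the strict comparison into a weak one. *)
move=> pf pg; apply: eq_ptime
  (ptime_lt_add (ptime_bits pf) (ptime_bits pg) (ptime_const [:: true])) => x.
by rewrite !bitsK addn1 ltnS.
Qed.

Lemma ptime_eqn (f g : X -> nat) :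
  ptime f -> ptime g -> ptime (fun x => f x == g x).
Proof.
move=> pf pg.
apply: eq_ptime (ptime_and (ptime_leq pf pg) (ptime_leq pg pf)) => x.
by rewrite eqn_leq.
Qed.

End NatComparison.

(** * The algorithm *)

Section Separator.
Variables (T : eqType) (x0 : T) (arc : rel T) (S Z : pred T) (U : seq T).
Implicit Types (h : seq (T * T)) (x y : T).

(* An auction is the list of its bids (x, y), latest first; the last bidder
   for y owns y. *)
Definition bids h y := [seq e <- h | e.2 == y].

Definition owns h x y :=
  ~~ nilp (bids h y) && ((head (x0, x0) (bids h y)).1 == x).

Definition is_free h x := ~~ has (owns h x) U.

(** Bid counts act as prices: x wants a cheapest adjacent right vertex. *)
Definition best h x y :=
  ~~ has (fun y' => [&& ~~ S y', arc x y' &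
                        ~~ (size (bids h y) <= size (bids h y'))]) U.

Definition may_bid h (e : T * T) :=
  [&& ~~ Z e.1, ~~ S e.2, arc e.1 e.2, is_free h e.1, best h e.1 e.2 &
      size (bids h e.2) <= size (x0 :: U)].

Definition candidates h :=
  [seq e <- [seq (x, y) | x <- U, y <- U] | may_bid h e].

Definition bid h :=
  if nilp (candidates h) then h else head (x0, x0) (candidates h) :: h.

(* Nobody bids for a y with more than size U + 1 bids, so that the auction is
   over after (size U + 2) ^ 2 steps. *)
Definition auction :=
  foldl (fun h (_ : T * T) => bid h) [::]
    [seq (x, y) | x <- [:: x0, x0 & U], y <- [:: x0, x0 & U]].

(* The length of [gap h] is a positive number at most size U + 1 that is not
   the number of bids for any y. *)
Definition gap h : seq T :=
  foldl (fun g (_ : T) => if has (fun y => (size (bids h y) <= size g) &&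
      (size g <= size (bids h y))) U then x0 :: g else g) [:: x0] U.

Definition is_high h y := ~~ (size (bids h y) <= size (gap h)).

Definition low_mate h x := has (fun y => owns h x y && ~~ is_high h y) U.

(* The left vertices with [low_mate] and the right vertices with [is_high]
   cover all arcs and are as many as the matched pairs. *)
Definition separator :=
  [seq x <- U | (Z x || low_mate auction x) && (S x || is_high auction x)].

End Separator.

(* The temporal edge between u and v at time t is the triple (u, (v, t)). *)
Notation node := (nat * (nat * nat))%type.

Definition time (x : node) : nat := x.2.2.

Definition incident (v : nat) (x : node) : bool := (x.1 == v) || (x.2.1 == v).

Definition precedes (x y : node) : bool :=
  (incident x.1 y || incident x.2.1 y) && (time x <= time y).

Definition node0 : node := (0, (0, 0)).

Definition cut_window (s z : nat) (U : seq node) : seq node :=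
  separator node0 precedes (incident s) (incident z) U.

(* The length of j is the level: this is t rounded down to a multiple of
   2 ^ size j. *)
Definition floor_bits (j t : seq bool) : seq bool :=
  flatten [seq [:: false] | _ <- j] ++ drop (size j) t.

Definition in_window (b : seq bool) (l : nat) (x : node) : bool :=
  (bits_val b <= time x) && (time x < bits_val b + l).

Definition residual (b : seq bool) (l : nat) (U r : seq node) : seq node :=
  [seq x <- U | in_window b l x && ~~ has (eq_op x) r].

(** The windows of a level are indexed by edges: a chain in any window of the level also lies in the
    window at the rounded time of its first edge. A window met a second time contributes an empty
    separator. *)
Definition cut_level (s z l : nat) (U : seq node) (j : seq bool) (r : seq node) :=
  foldl (fun r x =>
    cut_window s z (residual (floor_bits j (bits (time x))) l U r) ++ r) r U.

(** The bit list in the state is a level counter of which only the length matters. It shrinks from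
    k, the length of [bits l], to 0, and [true :: bits l] provides the k + 1 rounds. *)
Definition cut_levels (s z l : nat) (U : seq node) : seq node * seq bool :=
  foldl (fun st (_ : bool) => (cut_level s z l U st.2 st.1, behead st.2))
    ([::], bits l) (true :: bits l).

(** Each undirected edge enters once, with its smaller end first; the output takes both orientations
    of the chosen edges. *)
Definition solve (es : seq node) (s z l : nat) : seq node :=
  let r := (cut_levels s z l [seq e <- es | e.1 <= e.2.1]).1 in
  [seq e <- es | has (eq_op e) r || has (eq_op (e.2.1, (e.1, e.2.2))) r].

(** * Running time of the algorithm *)

Section PtimeNodes.
Context {X : Type} {ex : encodable X}.

Lemma ptime_eq_node (f g : X -> node) :
  ptime f -> ptime g -> ptime (fun x => f x == g x).
Proof.
move=> pf pg; apply: (@eq_ptime _ _ _ _ (fun x => ((f x).1 == (g x).1) &&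
  (((f x).2.1 == (g x).2.1) && ((f x).2.2 == (g x).2.2)))).
  by move=> x; case: (f x) (g x) => a [b c] [a' [b' c']].
by do ![apply: ptime_and]; apply: ptime_eqn; ptime_tac.
Qed.

Lemma ptime_time (f : X -> node) : ptime f -> ptime (fun x => time (f x)).
Proof. by move=> pf; rewrite /time; ptime_tac. Qed.

Lemma ptime_incident (v : X -> nat) (f : X -> node) :
  ptime v -> ptime f -> ptime (fun x => incident (v x) (f x)).
Proof.
by move=> pv pf; rewrite /incident; apply: ptime_or; apply: ptime_eqn; ptime_tac.
Qed.

Lemma ptime_precedes (f g : X -> node) :
  ptime f -> ptime g -> ptime (fun x => precedes (f x) (g x)).
Proof.
move=> pf pg; rewrite /precedes; apply: ptime_and.
  by apply: ptime_or; apply: ptime_incident; ptime_tac.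
by apply: ptime_leq; apply: ptime_time.
Qed.

End PtimeNodes.

Ltac ptime_sep := fail.
Ltac ptime_ext ::=
  match goal with
  | H : ptime ?f |- ptime (fun p => ?f (@?g p)) =>
      apply: (@ptime_comp _ _ _ _ _ _ g f); [|exact: H]
  | |- ptime (fun p => size (@?f p) <= size (@?g p)) =>
      apply: (@ptime_size_le _ _ _ _ _ _ f g)
  | |- ptime (fun p => @eq_op Datatypes_nat__canonical__eqtype_Equality
        (@?f p) (@?g p)) =>
      apply: (@ptime_eqn _ _ f g)
  | |- ptime (fun p => eq_op (@?f p) (@?g p)) => apply: (@ptime_eq_node _ _ f g)
  | |- ptime (fun p => leq (@?f p) (@?g p)) => apply: (@ptime_leq _ _ f g)
  | |- ptime (fun p => time (@?f p)) => apply: (@ptime_time _ _ f)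
  | |- ptime (fun p => incident (@?f p) (@?g p)) => apply: (@ptime_incident _ _ f g)
  | |- ptime (fun p => precedes (@?f p) (@?g p)) => apply: (@ptime_precedes _ _ f g)
  | |- _ => ptime_sep
  end.

Lemma ptime_bids X {ex : encodable X} (h : X -> seq (node * node))
    (y : X -> node) :
  ptime h -> ptime y -> ptime (fun x => bids (h x) (y x)).
Proof. by move=> ph py; rewrite /bids; ptime_tac. Qed.

Ltac ptime_sep ::=
  lazymatch goal with
  | |- ptime (fun p => @bids _ (@?h p) (@?y p)) => apply: (@ptime_bids _ _ h y)
  end.

Lemma ptime_owns X {ex : encodable X} (h : X -> seq (node * node))
    (f g : X -> node) :
  ptime h -> ptime f -> ptime g ->
  ptime (fun x => owns node0 (h x) (f x) (g x)).
Proof. by move=> ph pf pg; rewrite /owns; ptime_tac. Qed.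

Lemma ptime_gap X {ex : encodable X} (U : X -> seq node)
    (h : X -> seq (node * node)) :
  ptime U -> ptime h -> ptime (fun x => gap node0 (U x) (h x)).
Proof.
move=> pU ph; rewrite /gap.
apply: (@ptime_foldl_add _ _ _ _ _ _ _ _ _ (fun=> esize node0 + 1)).
- by ptime_tac.
- by ptime_tac.
- by ptime_tac.
- exact: polyb_const.
- move=> x b a; case: ifP => _; last exact: leq_addr.
  by rewrite esize_cons addn1 addnS addnC.
Qed.

Ltac ptime_sep ::=
  lazymatch goal with
  | |- ptime (fun p => @bids _ (@?h p) (@?y p)) => apply: (@ptime_bids _ _ h y)
  | |- ptime (fun p => @owns _ _ (@?h p) (@?f p) (@?g p)) =>
      apply: (@ptime_owns _ _ h f g)
  | |- ptime (fun p => @gap _ _ (@?U p) (@?h p)) => apply: (@ptime_gap _ _ U h)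
  end.

Lemma ptime_is_high X {ex : encodable X} (U : X -> seq node)
    (h : X -> seq (node * node)) (f : X -> node) :
  ptime U -> ptime h -> ptime f ->
  ptime (fun x => is_high node0 (U x) (h x) (f x)).
Proof. by move=> pU ph pf; rewrite /is_high; ptime_tac. Qed.

Lemma ptime_bid X {ex : encodable X} (s z : X -> nat) (U : X -> seq node)
    (h : X -> seq (node * node)) :
  ptime s -> ptime z -> ptime U -> ptime h ->
  ptime (fun x => bid node0 precedes (incident (s x)) (incident (z x)) (U x) (h x)).
Proof.
by move=> ps pz pU ph; rewrite /bid /candidates /may_bid /is_free /best; ptime_tac.
Qed.

Lemma esize_filter A {ea : encodable A} (p : pred A) (s : seq A) :
  esize (filter p s) <= esize s.
Proof.
elim: s => // a s IH; rewrite [filter _ _]/=; case: (p a).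
  by rewrite !esize_cons; lia.
by rewrite esize_cons; lia.
Qed.

(** A bid is drawn from the pairs over U, so a round lengthens the list of bids by an amount that
    does not depend on that list. *)
Lemma ptime_auction X {ex : encodable X} (s z : X -> nat) (U : X -> seq node) :
  ptime s -> ptime z -> ptime U ->
  ptime (fun x => auction node0 precedes (incident (s x)) (incident (z x)) (U x)).
Proof.
move=> ps pz pU; rewrite /auction.
have pUU : ptime (fun x => [seq (a, b) | a <- U x, b <- U x]) by ptime_tac.
have [c [N [K [k UUP]]]] := pUU.
apply: (@ptime_foldl_add _ _ _ _ _ _ _ _ _ (pol K k)).
- by apply: ptime_bid; ptime_tac.
- exact: ptime_const.
- by ptime_tac.
- exact: polyb_pol.
move=> x h a; rewrite /bid; set cs := candidates _ _ _ _ _ _.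
have csP : esize cs <= pol K k (esize x).
  by apply: leq_trans (UUP x).2; exact: esize_filter.
case: cs csP => [|e cs] lecs; first exact: leq_addr.
rewrite [nilp _]/= [head _ _]/= esize_cons.
rewrite addnC -addnS leq_add2l.
apply: (@leq_trans (pol K k (esize x))); last by apply: leq_pol; rewrite ?leq_addr.
by apply: leq_trans lecs; rewrite esize_cons ltnS leq_addr.
Qed.

Ltac ptime_sep ::=
  lazymatch goal with
  | |- ptime (fun p => @bids _ (@?h p) (@?y p)) => apply: (@ptime_bids _ _ h y)
  | |- ptime (fun p => @owns _ _ (@?h p) (@?f p) (@?g p)) =>
      apply: (@ptime_owns _ _ h f g)
  | |- ptime (fun p => @is_high _ _ (@?U p) (@?h p) (@?f p)) =>
      apply: (@ptime_is_high _ _ U h f)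
  | |- ptime (fun p => @auction _ _ _ (incident (@?s p)) (incident (@?z p))
        (@?U p)) =>
      apply: (@ptime_auction _ _ s z U)
  end.

Lemma ptime_cut_window X {ex : encodable X} (s z : X -> nat) (U : X -> seq node) :
  ptime s -> ptime z -> ptime U ->
  ptime (fun x => cut_window (s x) (z x) (U x)).
Proof.
move=> ps pz pU; rewrite /cut_window /separator /low_mate; ptime_tac.
Qed.

Lemma ptime_floor_bits X {ex : encodable X} (f g : X -> seq bool) :
  ptime f -> ptime g -> ptime (fun x => floor_bits (f x) (g x)).
Proof.
move=> pf pg; apply: ptime_cat; first by ptime_tac.
exact: ptime_drop.
Qed.

Lemma ptime_residual X {ex : encodable X} (b : X -> seq bool) (l : X -> nat)
    (U r : X -> seq node) :
  ptime b -> ptime l -> ptime U -> ptime r ->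
  ptime (fun x => residual (b x) (l x) (U x) (r x)).
Proof.
move=> pb pl pU pr; apply: (@ptime_filter _ _ _ _
  (fun x y => in_window (b x) (l x) y && ~~ has (eq_op y) (r x))) => //.
apply: ptime_and; last by ptime_tac.
apply: ptime_and.
- apply: (@eq_ptime _ _ _ _
    (fun p => bits_val (b p.1) < bits_val (bits (time p.2)) + bits_val [:: true])).
    by move=> p; rewrite bitsK addn1 ltnS.
  by apply: ptime_lt_add; [ptime_tac|apply: ptime_bits; ptime_tac|exact: ptime_const].
- apply: (@eq_ptime _ _ _ _
    (fun p => bits_val (bits (time p.2)) < bits_val (b p.1) + bits_val (bits (l p.1)))).
    by move=> p; rewrite !bitsK.
  by apply: ptime_lt_add; [apply: ptime_bits| |apply: ptime_bits]; ptime_tac.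
Qed.

Lemma ptime_cut_level X {ex : encodable X} (s z l : X -> nat) (U : X -> seq node)
    (j : X -> seq bool) (r : X -> seq node) :
  ptime s -> ptime z -> ptime l -> ptime U -> ptime j -> ptime r ->
  ptime (fun x => cut_level (s x) (z x) (l x) (U x) (j x) (r x)).
Proof.
move=> ps pz pl pU pj pr; rewrite /cut_level.
have [c [N [K [k UP]]]] := pU.
apply: (@ptime_foldl_add _ _ _ _ _ _ _ _ _ (pol K k)).
- apply: ptime_cat; last by ptime_tac.
  apply: ptime_cut_window; [by ptime_tac..|].
  apply: ptime_residual; [|by ptime_tac..].
  by apply: ptime_floor_bits; [ptime_tac|apply: ptime_bits; ptime_tac].
- by [].
- by [].
- exact: polyb_pol.
move=> x b a; set w := cut_window _ _ _.
have wP : esize w <= pol K k (esize x + esize a).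
  apply: leq_trans (esize_filter _ _) (leq_trans (esize_filter _ _) _).
  by apply: leq_trans (UP x).2 _; apply: leq_pol => //; exact: leq_addr.
have catP : esize (w ++ b) + 1 = esize w + esize b by exact: esize_cat.
by lia.
Qed.

(** Needed to iterate over the levels: the size bound in [ptime_cut_level] is some polynomial in r,
    which could blow up under iteration, whereas here r enters with coefficient one. *)
Lemma esize_cut_level s z l (U : seq node) j (r : seq node) :
  esize (cut_level s z l U j r) <= esize r + esize U * esize U.
Proof.
have foldP t : forall r', esize (foldl (fun r x => cut_window s z
      (residual (floor_bits j (bits (time x))) l U r) ++ r) r' t) <=
    esize r' + size t * esize U.
  elim: t => [|x t IH] r'; first by rewrite [foldl _ _ _]/= leq_addr.
  rewrite [foldl _ _ _]/=; apply: leq_trans (IH _) _; rewrite [size _]/= mulSn.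
  set w := cut_window _ _ _.
  have wP : esize w <= esize U.
    exact: leq_trans (esize_filter _ _) (esize_filter _ _).
  have catP : esize (w ++ r') + 1 = esize w + esize r' by exact: esize_cat.
  rewrite addnA leq_add2r; lia.
apply: leq_trans (foldP U r) _; rewrite leq_add2l leq_mul2r ltnW ?orbT //.
exact: size_le_esize.
Qed.

(** The argument has the shape of [enc_instance]: vertices, lifetime, edges, s, z and l. *)
Lemma ptime_solve :
  ptime (fun x : seq nat * (nat * (seq node * (nat * (nat * nat)))) =>
    solve x.2.2.1 x.2.2.2.1 x.2.2.2.2.1 x.2.2.2.2.2).
Proof.
rewrite /solve; apply: (@ptime_comp _ (seq node * seq node) _ _ _ _ (fun x => (x.2.2.1,
  (cut_levels x.2.2.2.1 x.2.2.2.2.1 x.2.2.2.2.2 [seq e <- x.2.2.1 | e.1 <= e.2.1]).1))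
  (fun p => [seq e <- p.1 | has (eq_op e) p.2 ||
     has (eq_op (e.2.1, (e.1, e.2.2))) p.2])); last by ptime_tac.
apply: ptime_pair; first by ptime_tac.
apply: ptime_fst; rewrite /cut_levels.
apply: (@ptime_foldl_add _ _ _ _ _ _ _ _ _ (fun n => n * n)).
- apply: ptime_pair; last by ptime_tac.
  by apply: ptime_cut_level; ptime_tac.
- by apply: ptime_pair; [exact: ptime_const|apply: ptime_bits; ptime_tac].
- by apply: ptime_cons; [exact: ptime_const|apply: ptime_bits; ptime_tac].
- exact: (polyb_mul polyb_id polyb_id).
move=> x [r j] b; rewrite !esize_pair [(_, _).1]/= [(_, _).2]/=.
set U := [seq e <- _ | _].
have UP : esize U <= esize x.
  apply: leq_trans (esize_filter _ _) _; rewrite esize_pair.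
  rewrite [X in _ <= (_ + X).+1]esize_pair [X in _ <= (_ + (_ + X).+1).+1]esize_pair.
  by lia.
have UUP : esize U * esize U <= (esize x + esize b) * (esize x + esize b).
  by apply: leq_mul; apply: leq_trans UP (leq_addr _ _).
have jP : esize (behead j) <= esize j.
  by case: (j) => // c j'; rewrite esize_cons [behead _]/=; lia.
rewrite addSn ltnS addnAC; apply: leq_add => //.
by apply: leq_trans (esize_cut_level _ _ _ _ _ _) _; rewrite leq_add2l.
Qed.

(** * Minimum separators *)

Lemma count_disjoint T (P Q R : pred T) (s : seq T) :
  (forall x, P x -> ~~ Q x) -> (forall x, P x || Q x -> R x) ->
  count P s + count Q s <= count R s.
Proof.
move=> PQ PQR; rewrite -count_predUI (@eq_count _ (predI P Q) pred0).
  by rewrite count_pred0 addn0; exact: sub_count.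
by move=> x /=; case Px: (P x) => //=; exact/negbTE/PQ.
Qed.

Lemma seq_argmin (T : eqType) (d : T -> nat) (s : seq T) x :
  x \in s -> exists2 y, y \in s & forall z, z \in s -> d y <= d z.
Proof.
elim: s x => // a [|b s] IH x _.
  by exists a => [|z]; rewrite ?mem_head // inE => /eqP->.
have [y ys yP] := IH b (mem_head _ _).
case: (leqP (d a) (d y)) => [le|/ltnW le].
- exists a => [|z]; first exact: mem_head.
  by rewrite inE => /predU1P[->//|/yP]; exact: leq_trans.
- exists y => [|z]; first by rewrite inE ys orbT.
  by rewrite inE => /predU1P[->//|/yP].
Qed.

Section SeparatorTheory.
Variables (T : eqType) (x0 : T) (arc : rel T) (S Z : pred T) (U : seq T).
Hypotheses (U_uniq : uniq U) (arc_refl : reflexive arc).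
Implicit Types (h : seq (T * T)) (x y : T) (K : pred T).

Local Notation d h y := (size (bids h y)).
Local Notation own := (owns x0).
Local Notation cands := (candidates x0 arc S Z U).
Local Notation step := (bid x0 arc S Z U).
Local Notation final := (auction x0 arc S Z U).
Local Notation gap_of := (gap x0 U).
Local Notation high := (is_high x0 U).
Local Notation low := (low_mate x0 U).
Local Notation sep := (separator x0 arc S Z U).

Lemma bids_cons e h y :
  bids (e :: h) y = if e.2 == y then e :: bids h y else bids h y.
Proof. by []. Qed.

Lemma owns_cons e h x y :
  own (e :: h) x y = if e.2 == y then e.1 == x else own h x y.
Proof. by rewrite /owns bids_cons; case: ifP. Qed.

Lemma owns_mem h x y : own h x y -> (x, y) \in h.
Proof.
elim: h => // e h IH; rewrite owns_cons inE.
case: eqP => [<- /eqP<-|_ /IH->]; last by rewrite orbT.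
by rewrite -surjective_pairing eqxx.
Qed.

(** Ownership is a matching by [inv_mate]. [inv_best] is an approximate complementary slackness: y
    was cheapest for x just before x bid for it, its count is unchanged while x owns it, and other
    counts only grow. *)
Record auction_inv h : Prop := AuctionInv {
  inv_bids : forall e, e \in h ->
    [&& e.1 \in U, e.2 \in U, ~~ Z e.1, ~~ S e.2 & arc e.1 e.2];
  inv_mate : forall x y y', own h x y -> own h x y' -> y = y';
  inv_best : forall x y y', own h x y -> y' \in U -> ~~ S y' -> arc x y' ->
    d h y <= (d h y').+1;
  inv_bound : forall y, d h y <= (size U).+2
}.

Lemma mem_candidates h e : e \in cands h =
  [&& may_bid x0 arc S Z U h e, e.1 \in U & e.2 \in U].
Proof.
rewrite mem_filter; congr andb; apply/allpairsP/andP => [[p [? ? ->]] //|[? ?]].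
by exists e; split=> //; exact: surjective_pairing.
Qed.

Lemma bid_inv h : auction_inv h -> auction_inv (step h).
Proof.
move=> inv; rewrite /bid.
case E: (cands h) => [|[a b] cs] //=.
have : (a, b) \in cands h by rewrite E mem_head.
rewrite mem_candidates => /and3P[/and5P[/= Za Sb arcab fa]].
case/andP=> /= /hasPn bb db aU bU.
have ddS y : d h y <= d ((a, b) :: h) y <= (d h y).+1.
  by rewrite bids_cons; case: ifP => _ /=; rewrite leqnn leqnSn.
(* The bidder a was free, so b becomes its only mate. *)
have fa' y : own h a y -> False.
  move=> ay; have /and5P[_ /= yU _ _ _] := inv_bids inv (owns_mem ay).
  by move/hasPn/(_ y yU)/negP: fa; apply.
split.
- move=> e; rewrite inE => /predU1P[->/=|/(inv_bids inv)//].
  by rewrite aU bU Za Sb arcab.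
- move=> x y y'; rewrite !owns_cons /=.
  case: (b =P y) => [<-|_]; case: (b =P y') => [<-|_] //; last exact: inv_mate.
  + by move=> /eqP<- ay'; case: (fa' _ ay').
  + by move=> xy /eqP ax; rewrite -ax in xy; case: (fa' _ xy).
- move=> x y y'; rewrite owns_cons !bids_cons [(a, b).1]/= [(a, b).2]/=.
  have /andP[] := ddS y'; rewrite bids_cons [(a, b).2]/= => lo _.
  case: eqP => [<- /eqP<- y'U Sy' ay'|/eqP/negPf bneqy xy y'U Sy' xy'].
    have := bb y' y'U; rewrite Sy' ay' /= negbK => le.
    by rewrite ltnS; exact: leq_trans le lo.
  apply: leq_trans (inv_best inv xy y'U Sy' xy') _.
  by rewrite ltnS.
- move=> y; rewrite bids_cons /=; case: eqP => [<-|_]; last exact: inv_bound.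
  exact: db.
Qed.

Lemma nil_inv : auction_inv [::].
Proof. by split. Qed.

Lemma auction_iter : final = iter ((size U).+2 * (size U).+2) step [::].
Proof.
rewrite -[X in X * _]/(size [:: x0, x0 & U]) -[X in _ * X]/(size [:: x0, x0 & U]).
rewrite /auction -(size_allpairs pair).
by elim: [seq _ | _ <- _, _ <- _] [::] => // e s IH h; rewrite [size _]/= iterSr -IH.
Qed.

Lemma auction_invP : auction_inv final.
Proof.
rewrite auction_iter; elim: (_ * _) => [|n IH]; first exact: nil_inv.
by rewrite iterS; exact: bid_inv.
Qed.

Lemma size_sum_bids h : (forall e, e \in h -> e.2 \in U) ->
  size h = \sum_(y <- U) d h y.
Proof.
elim: h => [|e h IH] hU; first by rewrite big1.
rewrite [size (e :: h)]/= IH; last by move=> f fh; apply: hU; rewrite inE fh orbT.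
transitivity (\sum_(y <- U) ((e.2 == y) + d h y)); last first.
  by apply: eq_bigr => y _; rewrite bids_cons; case: eqP.
rewrite big_split /= -add1n; congr addn.
rewrite -big_mkcond /= sum1_count.
transitivity (count_mem e.2 U); last by apply: eq_count => y; rewrite /= eq_sym.
by rewrite count_uniq_mem // hU // mem_head.
Qed.

(** A step with a candidate adds a bid, while the bid counts sum to at most |U| (|U| + 2), which is
    less than the number of steps. *)
Lemma auction_done : cands final = [::].
Proof.
have [inv _ _ bnd] := auction_invP.
have : size final < (size U).+2 * (size U).+2.
  rewrite size_sum_bids; last by move=> e /inv/and5P[].
  apply: (@leq_ltn_trans (\sum_(y <- U) (size U).+2)).
    by apply: leq_sum => y _.
  by rewrite big_const_seq count_predT iter_addn_0 mulnC ltn_mul2r /=.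
rewrite auction_iter; set n := (_ * _).
have : cands (iter n step [::]) = [::] \/ size (iter n step [::]) = n.
  elim: n => [|n [IH|IH]]; first by right.
  - by left; rewrite iterS /bid IH /= IH.
  - rewrite iterS; case E: (cands (iter n step [::])) => [|c cs].
      by left; rewrite /bid E.
    by right; rewrite /bid E /= IH.
by case=> // ->; rewrite ltnn.
Qed.

(** The length climbs from 1 as long as it is the bid count of some vertex. By the pigeonhole
    principle the |U| vertices cannot realise all of 1, ..., |U| + 1, so it stops at a missing
    value. *)
Lemma gapP h :
  [/\ 0 < size (gap_of h), size (gap_of h) <= (size U).+1 &
      {in U, forall y, d h y != size (gap_of h)}].
Proof.
pose hit i := has (fun y => d h y == i) U.
pose gstep (g : seq T) := if hit (size g) then x0 :: g else g.
have -> : gap_of h = iter (size U) gstep [:: x0].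
  rewrite /gap; move: [:: x0]; elim: {2 3}U => // a s IH g.
  rewrite [size (a :: s)]/= iterSr -IH /=; congr foldl.
  rewrite /gstep /hit; congr (if _ then _ else _).
  by apply: eq_has => y; rewrite -eqn_leq.
have H n : [/\ 0 < size (iter n gstep [:: x0]),
    size (iter n gstep [:: x0]) <= n.+1,
    forall i, 0 < i < size (iter n gstep [:: x0]) -> hit i &
    ~~ hit (size (iter n gstep [:: x0])) \/ size (iter n gstep [:: x0]) = n.+1].
  elim: n => [|n [g0 gn ghit gnP]]; first by split=> //; [case=> // [[]]|right].
  rewrite iterS; set g := iter n gstep _ in g0 gn ghit gnP *.
  rewrite {1 2 3 4 5}/gstep; case: ifP => hg; split=> //.
  - move=> i; rewrite /= ltnS [i <= _]leq_eqVlt => /andP[i0 /predU1P[->//|ig]].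
    by apply: ghit; rewrite i0.
  - by right; case: gnP => [/negP//|/= ->].
  - exact: leqW.
  - by left; rewrite hg.
have [g0 gm ghit gP] := H (size U); split=> //.
have ngh : ~~ hit (size (iter (size U) gstep [:: x0])).
  case: gP => // gE; apply/negP => hg.
  have : size (iota 1 (size U).+1) <= size [seq d h y | y <- U].
    apply: uniq_leq_size (iota_uniq _ _) _ => i.
    rewrite mem_iota add1n ltnS => /andP[i0].
    rewrite leq_eqVlt => /predU1P[->|im].
      by rewrite -gE; case/hasP: hg => y yU /eqP<-; exact: map_f.
    have ig : 0 < i < size (iter (size U) gstep [:: x0]).
      by rewrite i0 gE.
    by have /hasP[y yU /eqP<-] := ghit i ig; exact: map_f.
  by rewrite size_iota size_map ltnn.
by move=> y yU; apply: contra ngh => dy; apply/hasP; exists y.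
Qed.

Local Notation h := final.

(** If y is not high, its count is strictly below the gap. A free x could then still bid for its
    cheapest neighbour, against [auction_done]. So x owns some y1, and by [inv_best] the count of y1
    exceeds that of y by at most one: it cannot jump over the gap. *)
Lemma auction_cover x y : x \in U -> ~~ Z x -> y \in U -> ~~ S y -> arc x y ->
  high h y || low h x.
Proof.
move=> xU Zx yU Sy xy; case: (boolP (high h y)) => //=; rewrite negbK => ley.
have [g0 gm /(_ y yU) gy] := gapP h.
have {}ley : d h y < size (gap_of h) by rewrite ltn_neqAle gy.
have [inv mate best _] := auction_invP.
case: (boolP (is_free x0 U h x)) => [fx|].
  have [|y1] := @seq_argmin _ (fun y => d h y) [seq y' <- U | ~~ S y' & arc x y'] y.
    by rewrite mem_filter Sy xy.
  rewrite mem_filter => /andP[/andP[Sy1 xy1] y1U] y1P.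
  have : (x, y1) \in cands h.
    rewrite mem_candidates /= xU y1U !andbT; apply/and5P; split=> //=.
    apply/andP; split=> /=.
      apply/hasPn => y' y'U; apply/negP => /and3P[Sy' xy' /negP]; apply.
      by apply: y1P; rewrite mem_filter Sy' xy'.
    apply: leq_trans (y1P y _) _; first by rewrite mem_filter Sy xy.
    exact: ltnW (leq_trans ley gm).
  by rewrite auction_done.
rewrite negbK => /hasP[y1 y1U xy1]; apply/hasP; exists y1 => //; rewrite xy1 /= negbK.
by apply: leq_trans (best _ _ _ xy1 yU Sy xy) _.
Qed.

Definition separates K : Prop :=
  forall x p, {in x :: p, forall y, (y \in U) && ~~ K y} -> S x ->
    path arc x p -> ~~ Z (last x p).

(** Along a path that avoids the separator, the property of being in S or high propagates: such a
    vertex is neither in Z nor low-mated, so by [auction_cover] its successor is again in S or high.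
    In particular the last vertex is not in Z. *)
Lemma separator_separates : separates (mem sep).
Proof.
move=> x p pU Sx pth.
suff : {in x :: p, forall y, S y || high h y}.
  move/(_ _ (mem_last _ _)) => b; have := pU _ (mem_last x p).
  rewrite /= mem_filter b andbT; case/andP => ->.
  by rewrite andbT negb_or => /andP[].
have b0 : S x || high h x by rewrite Sx.
elim: p x b0 pU pth {Sx} => [|y p IH] x b pU.
  by move=> _ z; rewrite inE => /eqP->.
case/andP=> xy pth z; rewrite inE => /predU1P[->//|].
apply: IH pth z; last by move=> z zp; apply: pU; rewrite inE zp orbT.
have := pU x (mem_head _ _); rewrite /= mem_filter b andbT.
case/andP=> xU; rewrite xU andbT negb_or => /andP[Zx lx].
have /andP[yU _] : (y \in U) && ~~ (y \in sep).
  by apply: pU; rewrite !inE eqxx orbT.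
case Sy: (S y) => //=.
by have := auction_cover xU Zx yU (negbT Sy) xy; rewrite (negPf lx) orbF.
Qed.

Lemma low_mateP x : low h x -> exists2 y, y \in U & own h x y && ~~ high h y.
Proof. by case/hasP=> y yU ?; exists y. Qed.

(* If A is the set of vertices reached from S outside K, then the left vertices
   outside A and the right vertices in A or K cover all arcs. *)
Lemma separator_min K : separates K -> size sep <= count K U.
Proof.
move=> sepK; have [inv mate _ _] := auction_invP.
pose A x := `[< exists y p, [/\ {in y :: p, forall u, (u \in U) && ~~ K u},
  S y, path arc y p & last y p = x] >].
pose owner y := (head (x0, x0) (bids h y)).1.
pose matched y := ~~ nilp (bids h y).
have ownE x y : own h x y = matched y && (owner y == x) by [].
have matchedP y : matched y ->
    [&& owner y \in U, y \in U, ~~ Z (owner y), ~~ S y & arc (owner y) y].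
  move=> my; apply: inv (owns_mem _).
  by rewrite ownE my eqxx.
have AP x : A x -> [&& x \in U, ~~ K x & ~~ Z x].
  case/asboolP=> y [p [pU Sy pth <-]]; have := pU _ (mem_last y p).
  by case/andP=> -> -> /=; exact: sepK.
have A_step x y : A x -> y \in U -> arc x y -> A y || K y.
  move=> /asboolP[u [p [pU Su pth lx]]] yU xy; case: (boolP (K y)) => [|Ky].
    by rewrite orbT.
  rewrite orbF; apply/asboolP; exists u, (rcons p y); split=> //.
  - move=> v; rewrite -rcons_cons mem_rcons inE => /predU1P[->|/pU//].
    by rewrite yU.
  - by rewrite rcons_path pth lx.
  - by rewrite last_rcons.
have A_S x : x \in U -> S x -> A x || K x.
  move=> xU Sx; case: (boolP (K x)) => [|Kx]; first by rewrite orbT.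
  rewrite orbF; apply/asboolP; exists x, [::]; split=> //.
  by move=> u; rewrite inE => /eqP->; rewrite xU.
(* By reflexivity, a vertex outside S and Z has an arc between its left and right copies, so every
   vertex satisfies at least one of the two predicates; those satisfying both form the separator. *)
have cnt : size sep + size U <= count (fun x => Z x || low h x) U +
    count (fun x => S x || high h x) U.
  rewrite size_filter -(count_predUI (fun x => Z x || low h x)) addnC leq_add //.
  rewrite -(count_predT U) leq_eqVlt; apply/orP; left.
  apply/eqP/eq_in_count => x xU /=.
  case: (boolP (Z x)) => //= Zx; case: (boolP (S x)) => [|Sx]; first by rewrite orbT.
  have := auction_cover xU Zx xU Sx (arc_refl x).
  by case: (high h x); case: (low h x).
have cntZ : count (fun x => Z x || low h x) U <= count Z U + count (low h) U.
  by rewrite -count_predUI leq_addr.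
have cntS : count (fun x => S x || high h x) U <= count S U + count (high h) U.
  by rewrite -count_predUI leq_addr.
(* The cover is no larger than the matching: low-mated left vertices are owners of matched vertices
   that are not high, and high vertices have at least one bid. *)
have cntM : count (low h) U + count (high h) U <= count matched U.
  apply: leq_trans (@count_disjoint _ (fun y => matched y && ~~ high h y)
    (high h) _ _ _ _).
  - rewrite leq_add2r -!size_filter -[X in _ <= X](size_map owner).
    apply: uniq_leq_size.
      exact: filter_uniq.
    move=> x; rewrite mem_filter => /andP[/low_mateP[y yU /andP[]]].
    rewrite ownE => /andP[my /eqP<-] hy _; apply: map_f.
    by rewrite mem_filter my hy.
  - by move=> y /andP[].
  - move=> y /orP[/andP[]//|].
    by rewrite /is_high /matched; case: (bids h y).
(* Weak duality: an arc from A ends in A or K, so a matched pair has its left end outside A or its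
   right end in A or K. Distinct pairs have distinct owners. *)
have cntA : count matched U <= count (fun x => ~~ Z x && ~~ A x) U +
    count (fun y => ~~ S y && (A y || K y)) U.
  rewrite -size_filter -(count_predC (fun y => A (owner y))) addnC !count_filter.
  apply: leq_add; last first.
    apply: sub_count => y /andP[Ay /matchedP/and5P[_ yU _ -> /= oy]].
    exact: A_step Ay yU oy.
  rewrite -!size_filter -(size_map owner); apply: uniq_leq_size.
    rewrite map_inj_in_uniq ?filter_uniq // => y y'; rewrite !mem_filter.
    move=> /andP[/andP[_ my] _] /andP[/andP[_ my'] _] oE.
    by apply: (mate (owner y)); rewrite ownE ?my ?my' ?oE eqxx.
  move=> _ /mapP[y + ->]; rewrite !mem_filter /= => /andP[/andP[-> my] _].
  by have /and5P[-> _ -> _ _] := matchedP y my.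
have cntZA : count Z U + count (fun x => ~~ Z x && ~~ A x) U <= count (predC A) U.
  apply: count_disjoint => x /=; first by case: (Z x).
  case/orP=> [Zx|/andP[]//]; apply/negP => /AP/and3P[_ _].
  by rewrite Zx.
have cntSA : count S U + count (fun y => ~~ S y && (A y || K y)) U <=
    count A U + count K U.
  apply: (@leq_trans (count (predU A K) U)); last first.
    by rewrite -count_predUI leq_addr.
  rewrite -[count S U](@eq_in_count _ (fun x => S x && (A x || K x))); last first.
    by move=> x xU /=; case Sx: (S x) => //=; exact: A_S.
  apply: count_disjoint => x /=; first by case: (S x).
  by case/orP=> /andP[].
have := count_predC A U.
lia.
Qed.

End SeparatorTheory.

(** * Levels *)

Lemma bits_val_lt s : bits_val s < 2 ^ size s.
Proof. by elim: s => //= b s IH; rewrite expnS; case: b; lia. Qed.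

Lemma bits_val_drop n s : bits_val (drop n s) = bits_val s %/ 2 ^ n.
Proof.
elim: n s => [|n IH] [|b s]; rewrite ?div0n ?divn1 //=.
rewrite IH expnS divnMA; congr (_ %/ _).
by rewrite addnC -muln2 divnMDl // divn_small ?addn0 //; case: b.
Qed.

Lemma bits_val_floor j n :
  bits_val (floor_bits j (bits n)) = 2 ^ size j * (n %/ 2 ^ size j).
Proof.
rewrite /floor_bits -[in RHS](bitsK n) -bits_val_drop.
elim: {1 3}j => [|b j' IH] /=; first by rewrite mul1n.
by rewrite add0n IH expnS -mul2n mulnA.
Qed.

Lemma size_bits_le l : 0 < l -> 2 ^ (size (bits l)).-1 <= l.
Proof.
move=> l0; rewrite -{2}(bitsK l) /bits.
have : bin_of_nat l <> BinNums.N0 by move=> E; rewrite -(bin_of_natK l) E in l0.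
case: (bin_of_nat l) => // p _; elim: p => //= p.
all: by case: (bits_pos p) => //= b s; rewrite expnS; lia.
Qed.

Lemma path_precedes_time x p : path precedes x p ->
  {in x :: p, forall y, time x <= time y <= time (last x p)}.
Proof.
elim: p x => [|y p IH] x /=.
  by move=> _ w; rewrite inE => /eqP->; rewrite leqnn.
case/andP=> /andP[_ xy] /IH{}IH w; rewrite inE => /predU1P[->|/IH/andP[yw ->]].
  rewrite leqnn; apply: leq_trans xy _.
  by have /andP[] := IH y (mem_head _ _).
by rewrite (leq_trans xy yw).
Qed.

Section Levels.
Variables (s z l : nat) (U : seq node).
Hypothesis U_uniq : uniq U.
Implicit Types (b : nat) (r : seq node) (K : pred node).

Definition hits K b : Prop := forall x p,
  {in x :: p, forall y, [&& y \in U, ~~ K y & b <= time y < b + l]} ->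
  incident s x -> path precedes x p -> ~~ incident z (last x p).

Definition on_chain K b (y : node) : bool := `[< exists x p,
  [/\ {in x :: p, forall u, [&& u \in U, ~~ K u & b <= time u < b + l]},
      incident s x, path precedes x p, incident z (last x p) & y \in x :: p] >].

Lemma sub_hits K K' b : {subset K <= K'} -> hits K b -> hits K' b.
Proof.
move=> KK' hK x p pP; apply: hK => y /pP/and3P[-> Ky ->]; rewrite andbT /=.
by apply: contra Ky; exact: KK'.
Qed.

Lemma hits_on_chain K b y : hits K b -> ~~ on_chain K b y.
Proof.
move=> hK; apply/asboolP=> -[x [p [pU sx pth zx _]]].
by move: (hK x p pU sx pth); rewrite zx.
Qed.

Lemma precedes_refl : reflexive precedes.
Proof. by move=> x; rewrite /precedes /incident eqxx leqnn. Qed.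

Section Window.
Variables (b : seq bool) (r : seq node).

Local Notation W := (residual b l U r).
Local Notation C := (cut_window s z W).

Lemma mem_residual y : (y \in W) =
  [&& y \in U, y \notin r & bits_val b <= time y < bits_val b + l].
Proof.
rewrite mem_filter andbC; congr andb; rewrite andbC; congr andb.
by rewrite -has_pred1; congr negb; apply: eq_has => x; exact: eq_sym.
Qed.

Lemma residual_uniq : uniq W. Proof. exact: filter_uniq. Qed.

Lemma cut_window_hits : hits (mem (C ++ r)) (bits_val b).
Proof.
move=> x p pP sx pth.
apply: (separator_separates residual_uniq (x0 := node0) _ sx pth) => y /pP.
by rewrite mem_residual /= mem_cat negb_or => /and3P[-> /andP[-> ->] ->].
Qed.

(** Minimality is applied to the part of K lying on surviving chains of the window. This part
    already separates, because all vertices of a surviving chain are on a chain. *)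
Lemma size_cut_window K : hits K (bits_val b) ->
  size C <= count (fun y => K y && on_chain (mem r) (bits_val b) y) U.
Proof.
move=> hK.
pose K' y := K y && on_chain (mem r) (bits_val b) y.
have := @separator_min _ node0 _ (incident s) (incident z) _ residual_uniq
  precedes_refl K'; rewrite -/(cut_window s z W) => /(_ _)/leq_trans; apply.
  move=> x p pP sx pth; apply/negP => zx.
  have pU : {in x :: p, forall y,
      [&& y \in U, y \notin r & bits_val b <= time y < bits_val b + l]}.
    by move=> y /pP/andP[+ _]; rewrite mem_residual.
  suff : ~~ incident z (last x p) by rewrite zx.
  apply: (hK x p _ sx pth) => y yp; have /and3P[-> yr ->] := pU y yp.
  rewrite andbT /=; have /andP[_] := pP y yp; apply: contra => Ky; rewrite /K' Ky /=.
  by apply/asboolP; exists x, p; split.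
by rewrite /residual count_filter; apply: sub_count => y /andP[].
Qed.

End Window.
Lemma on_chain_span K b y : on_chain K b y -> b <= time y < b + l.
Proof. by case/asboolP=> x [p [pU _ _ _ yp]]; have /and3P[] := pU y yp. Qed.

(* If an edge y lies on a chain in each of two windows starting at b1 < b2, then
   the part before y of the later chain and the part after y of the earlier one
   form a chain inside [b2, b1 + l). *)
Lemma on_chain_meet K b b1 b2 y :
  b1 <= b <= b2 -> on_chain K b1 y -> on_chain K b2 y -> ~ hits K b.
Proof.
move=> /andP[b1b bb2] /asboolP[x1 [p1 [p1U _ pth1 z1 yp1]]].
move=> /asboolP[x2 [p2 [p2U s2 pth2 _ yp2]]] hK.
case/splitPl: yp1 p1U pth1 z1 => q1 q1' q1y p1U; rewrite cat_path last_cat q1y.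
case/andP=> _ pth1 z1.
case/splitPl: yp2 p2U pth2 => q2 q2' q2y p2U; rewrite cat_path => /andP[pth2 _].
suff : ~~ incident z (last x2 (q2 ++ q1')) by rewrite last_cat q2y z1.
apply: hK s2 _; last by rewrite cat_path pth2 q2y.
have yP1 : time y < b1 + l.
  have := p1U y; rewrite -cat_cons mem_cat -q1y mem_last => /(_ isT).
  by case/and3P=> _ _ /andP[].
have yP2 : b2 <= time y.
  have := p2U y; rewrite -cat_cons mem_cat -q2y mem_last => /(_ isT).
  by case/and3P=> _ _ /andP[].
move=> u; rewrite -cat_cons mem_cat => /orP[uq|uq].
- have uq2 : u \in x2 :: q2 ++ q2' by rewrite -cat_cons mem_cat uq.
  have /and3P[-> -> /andP[ub _]] := p2U u uq2.
  by have /andP[_] := path_precedes_time pth2 uq; rewrite q2y /=; lia.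
- have uq1 : u \in x1 :: q1 ++ q1' by rewrite -cat_cons mem_cat uq orbT.
  have uqy : u \in y :: q1' by rewrite inE uq orbT.
  have /and3P[-> -> /andP[_ ub]] := p1U u uq1.
  by have /andP[+ _] := path_precedes_time pth1 uqy; rewrite /=; lia.
Qed.

(** Two reasons why windows of level j do not interfere: they are disjoint, or no chain is left in
    the windows of level j + 1. *)
Definition level_ready (j : nat) K : Prop :=
  l <= 2 ^ j \/ forall c, hits K (2 ^ j.+1 * c).

Lemma on_chain_uniq K j c1 c2 y : level_ready j K ->
  on_chain K (2 ^ j * c1) y -> on_chain K (2 ^ j * c2) y -> c1 = c2.
Proof.
wlog lt12 : c1 c2 / c1 < c2 => [IH rdy H1 H2|].
  by case: (ltngtP c1 c2) => // ?; [|apply/esym]; exact: IH rdy _ _.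
case=> [lej H1 H2|rdy H1 H2].
  have := on_chain_span H1; have := on_chain_span H2.
  have : 2 ^ j * c1.+1 <= 2 ^ j * c2 by rewrite leq_mul2l lt12 orbT.
  by rewrite mulnS; lia.
(* A window with even c is one of level j + 1 and has no chain left. So c1 and c2 are odd, and the
   even number c2 - 1, twice [c2./2], lies between them; [on_chain_meet] applies there. *)
have := rdy c2./2; rewrite expnSr -mulnA mul2n => hc2; exfalso.
apply: on_chain_meet H1 H2 hc2; rewrite !leq_mul2l.
have oddc c : on_chain K (2 ^ j * c) y -> odd c.
  move=> H; apply/negPn/negP => ev; have := rdy c./2.
  rewrite expnSr -mulnA mul2n even_halfK //.
  by move/(hits_on_chain y); rewrite H.
by have := oddc c1; have := oddc c2; have := odd_double_half c2; lia.
Qed.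

Section Level.
Variables (j : seq bool) (r : seq node) (K : pred node).
Hypotheses (ready : level_ready (size j) (mem r)) (K_hits : forall b, hits K b).

Local Notation base x := (bits_val (floor_bits j (bits (time x)))).
Local Notation pass := (foldl (fun r x =>
  cut_window s z (residual (floor_bits j (bits (time x))) l U r) ++ r) r).

(** Chains are measured against r, the set at the start of the level, for which [on_chain_uniq]
    holds. The parts of K charged to distinct windows are then disjoint and their sizes add up to at
    most that of K. *)
Lemma level_prefix t :
  [/\ {subset r <= pass t}, {in t, forall x, hits (mem (pass t)) (base x)} &
      size (pass t) <= size r +
        count (fun y => K y && has (fun x => on_chain (mem r) (base x) y) t) U].
Proof.
elim/last_ind: t => [|t x [sub hit bnd]]; first by split=> //=; lia.
rewrite -cats1 foldl_cat /=; set r' := pass t in sub hit bnd *.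
set C := cut_window _ _ _.
have sub' : {subset r' <= C ++ r'} by move=> y; rewrite mem_cat => ->; rewrite orbT.
have hitx : hits (mem (C ++ r')) (base x) by exact: cut_window_hits.
split=> [y /sub/sub' //|w|].
  by rewrite mem_cat inE => /orP[/hit|/eqP->//]; apply: sub_hits.
rewrite size_cat.
have szC (K' : pred node) : hits K' (base x) -> size C <=
    count (fun y => K' y && on_chain (mem r') (base x) y) U.
  exact: size_cut_window.
have chain_sub y : on_chain (mem r') (base x) y -> on_chain (mem r) (base x) y.
  case/asboolP=> w [p [pU sw pth zp yp]]; apply/asboolP; exists w, p; split=> //.
  move=> u /pU/and3P[-> ur' ->]; rewrite andbT /=.
  by apply: contra ur'; exact: sub.
(* If the window was treated before, [r'] hits it and the new separator is empty. Otherwise a new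
   part of K pays for it. *)
have [/hasP[w wt /eqP bE]|/hasPn nb] := boolP (has (fun w => base w == base x) t).
  have -> : size C = 0.
    apply/eqP; rewrite -leqn0; apply: leq_trans (szC (mem r') _) _.
      by rewrite -bE; exact: hit.
    rewrite leqn0 -(count_pred0 U); apply/eqP/eq_count => y /=.
    by apply/negbTE; rewrite negb_and orbC hits_on_chain // -bE; exact: hit.
  rewrite add0n; apply: leq_trans bnd _; rewrite leq_add2l; apply: sub_count => y /=.
  by case/andP=> -> H; rewrite has_cat H.
rewrite addnC; apply: leq_trans (leq_add bnd (szC K _)) _; first exact: K_hits.
rewrite -addnA leq_add2l; apply: count_disjoint => y /=.
  case/andP=> Ky /hasP[w wt ow]; rewrite Ky /=; apply/negP => /chain_sub ox.
  move/negP: (nb w wt); apply; move: ow ox; rewrite !bits_val_floor => ow ox.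
  by rewrite (on_chain_uniq ready ow ox).
case/orP=> /andP[-> H] /=; rewrite has_cat; first by rewrite H.
by rewrite /= chain_sub // orbT.
Qed.

Lemma cut_levelP : let r' := cut_level s z l U j r in
  [/\ {subset r <= r'}, forall c, hits (mem r') (2 ^ size j * c) &
      size r' <= size r + count K U].
Proof.
have [sub hit bnd] := level_prefix U; split=> //; last first.
  by apply: leq_trans bnd _; rewrite leq_add2l; apply: sub_count => y /andP[].
(* The window at the rounded time of the first edge x starts no earlier than the given one and no
   later than x, so it contains the whole chain. *)
move=> c x p pP sx pth; have /and3P[xU _ /andP[cx _]] := pP x (mem_head _ _).
apply: (hit x xU x p _ sx pth) => y yp; have /and3P[-> -> /andP[_ yc]] := pP y yp.
have /andP[xy _] := path_precedes_time pth yp.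
rewrite bits_val_floor; have P2 : 0 < 2 ^ size j by rewrite expn_gt0.
have le1 : c <= time x %/ 2 ^ size j by rewrite leq_divRL // mulnC.
have le2 : 2 ^ size j * c <= 2 ^ size j * (time x %/ 2 ^ size j).
  by rewrite leq_mul2l le1 orbT.
have le3 : 2 ^ size j * (time x %/ 2 ^ size j) <= time x.
  by rewrite mulnC leq_divM.
by rewrite /=; lia.
Qed.

End Level.

(** Each level costs at most the part of K in U and makes the next finer level ready. Level 0 treats
    the multiples of 1, that is, all windows; the counter then stays empty and level 0 remains
    ready. *)
Lemma cut_levels_gen K (c : seq bool) j r : (forall b, hits K b) ->
  level_ready (size j) (mem r) ->
  let st := foldl (fun st (_ : bool) =>
    (cut_level s z l U st.2 st.1, behead st.2)) (r, j) c in
  [/\ {subset r <= st.1}, size st.1 <= size r + size c * count K U &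
      size j < size c -> forall b, hits (mem st.1) b].
Proof.
move=> K_hits; elim: c j r => [|a c IH] j r ready; first by split=> //=; lia.
have [sub hit bnd] := cut_levelP ready K_hits.
rewrite [foldl _ _ _]/=; set r' := cut_level _ _ _ _ _ _ in sub hit bnd *.
clearbody r'.
have ready' : level_ready (size (behead j)) (mem r').
  right=> d; case: (j) hit => [|a' j'] hit; last exact: hit.
  by rewrite expnS expn0 muln1; have := hit (2 * d); rewrite mul1n.
have [sub' bnd' hit'] := IH (behead j) r' ready'; split.
- by move=> y /sub/sub'.
- by apply: leq_trans bnd' _; rewrite [size (a :: c)]/= mulSn; lia.
case: j {IH ready ready' bnd bnd'} hit hit' sub' => [|a' j'] hit hit' sub' lt b.
  by apply: sub_hits sub' _; have := hit b; rewrite mul1n.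
exact: hit'.
Qed.

Lemma cut_levelsP K : (forall b, hits K b) ->
  let r := (cut_levels s z l U).1 in
  size r <= (size (bits l)).+1 * count K U /\ forall b, hits (mem r) b.
Proof.
(* The windows of the first level are disjoint, as l is less than [2 ^ size (bits l)]. *)
move=> K_hits; have rdy : level_ready (size (bits l)) (mem [::] : pred node).
  by left; rewrite ltnW // -{1}(bitsK l) bits_val_lt.
have [_ bnd hit] := cut_levels_gen (true :: bits l) K_hits rdy.
by split=> //; exact: hit.
Qed.

End Levels.

(** * Temporal paths and chains of edges *)

Section Conversion.
Variables (n tau : nat).
Implicit Types (e : tedge 'I_n tau) (E F : {set tedge 'I_n tau}).

Definition node_of e : node := (esrc e : nat, (edst e : nat, etime e)).

Definition flip e : tedge 'I_n tau := (edst e, esrc e, e.2).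

Lemma node_of_inj : injective node_of.
Proof.
move=> [[u v] t] [[u' v'] t']; rewrite /node_of /esrc /edst /etime /=.
by case=> /val_inj-> /val_inj-> /val_inj->.
Qed.

Lemma flip_mem E e : undirected E -> (flip e \in E) = (e \in E).
Proof. by case: e => [[u v] t] und; rewrite und. Qed.

Definition link e e' := (edst e == esrc e') && (etime e <= etime e').

Lemma path_link_time e p : path link e p ->
  {in e :: p, forall f, etime f <= etime (last e p)}.
Proof.
elim: p e => [|e' p IH] e /=; first by move=> _ f; rewrite inE => /eqP->.
case/andP=> /andP[_ le] /IH{}IH f; rewrite inE => /predU1P[->|/IH//].
exact: leq_trans le (IH _ (mem_head _ _)).
Qed.

Lemma path_link_src e p : path link e p ->
  map (@esrc _ _) (e :: p) = belast (esrc e) (map (@edst _ _) (e :: p)).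
Proof.
elim: p e => //= e' p IH e /andP[/andP[/eqP -> _] /IH/= ->] //.
Qed.

Section Reach.
Variables (E : {set tedge 'I_n tau}) (s : 'I_n) (b : nat).

(** The visited vertices are s and the heads of the edges. Their being distinct yields both
    uniqueness conditions of [temporal_path], since the tails are that list without its last
    entry. *)
Definition simple_walk (w : 'I_n) e p : Prop :=
  [/\ {subset e :: p <= E}, esrc e = s, edst (last e p) = w, path link e p &
      uniq (s :: map (@edst _ _) (e :: p))].

Lemma simple_walk_temporal_path w e p :
  simple_walk w e p -> temporal_path E s w e p.
Proof.
case=> sub se we pth unq; rewrite /temporal_path se we !eqxx path_link_src // se.
move: (unq); rewrite lastI rcons_uniq => /andP[_ ->].
rewrite [X in [&& X, _, _, _ & _]](introT allP sub) [path _ _ _]pth.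
by case/andP: unq.
Qed.

Definition reach (w : 'I_n) (t : nat) : Prop :=
  w = s \/ exists e p, [/\ simple_walk w e p, b <= etime e & etime (last e p) <= t].

Lemma reach_le w t t' : t <= t' -> reach w t -> reach w t'.
Proof.
move=> le [->|[e [p [W be te]]]]; [by left|right].
by exists e, p; split=> //; exact: leq_trans te le.
Qed.

(** If the head of e was visited before, the path is cut there; otherwise e is appended. Either way
    it stays simple. *)
Lemma reach_edge e t : e \in E -> reach (esrc e) t -> t <= etime e ->
  b <= etime e -> reach (edst e) (etime e).
Proof.
move=> eE R te be; have [->|ns] := eqVneq (edst e) s; first by left.
right; have [es|nse] := eqVneq (esrc e) s.
  exists e, [::]; split=> //; split=> //=; last by rewrite inE eq_sym ns.
  by move=> f; rewrite inE => /eqP->.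
case: R => [/eqP|[f [p [[sub sf lf pth unq] bf lt]]]]; first by rewrite (negPf nse).
have [/mapP[g gp ge]|ne] := boolP (edst e \in map (@edst _ _) (f :: p)).
  move: sub pth unq lt {lf}; case/splitPl: gp => p1 p2 lg sub pth unq lt.
  exists f, p1; split=> //; last first.
    have := path_link_time pth (_ : last f p1 \in f :: p1 ++ p2).
    rewrite -cat_cons mem_cat mem_last => /(_ isT) le.
    exact: leq_trans le (leq_trans lt te).
  split=> //; first by move=> g' g'p; apply: sub; rewrite -cat_cons mem_cat g'p.
  - by rewrite lg ge.
  - by move: pth; rewrite cat_path => /andP[].
  - by move: unq; rewrite -cat_cons map_cat -cat_cons cat_uniq => /andP[].
exists f, (rcons p e); split=> //; last by rewrite last_rcons.
split=> //.
- by move=> g; rewrite -rcons_cons mem_rcons inE => /predU1P[->|/sub].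
- by rewrite last_rcons.
- by rewrite rcons_path pth /link lf eqxx (leq_trans lt te).
- rewrite -rcons_cons map_rcons -rcons_cons rcons_uniq unq andbT.
  by rewrite inE negb_or ns.
Qed.

Hypothesis E_und : undirected E.

Lemma incident_node (c : 'I_n) e :
  incident c (node_of e) = (esrc e == c) || (edst e == c).
Proof. by []. Qed.

Lemma reach_incident (c w : 'I_n) e t : e \in E -> reach c t -> t <= etime e ->
  b <= etime e -> incident c (node_of e) -> incident w (node_of e) ->
  reach w (etime e).
Proof.
move=> eE R te be; have R' := reach_le te R; rewrite !incident_node.
case/orP=> /eqP ec; case/orP=> /eqP <-; rewrite ?ec //.
- by apply: reach_edge te be; rewrite ?ec.
- by apply: (@reach_edge (flip e) t); rewrite ?flip_mem // [esrc _]ec.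
Qed.

(** Successive edges of a chain share an end but need not line up as a walk. The induction therefore
    claims that both ends of the current edge are reached by its time. *)
Lemma reach_chain x p :
  {in x :: p, forall y, b <= time y /\ exists2 e, e \in E & y = node_of e} ->
  incident s x -> path precedes x p ->
  forall w : 'I_n, incident w (last x p) -> reach w (time (last x p)).
Proof.
move=> pP sx.
have start : forall w : 'I_n, incident w x -> reach w (time x).
  have [bx [e eE ex]] := pP x (mem_head _ _); rewrite ex in bx sx * => w wx.
  by apply: (@reach_incident s w e b) => //; left.
elim: p x {sx} start pP => [|y p IH] x start pP //= /andP[xy]; apply: IH; last first.
  by move=> u up; apply: pP; rewrite inE up orbT.
move=> w wy; case/andP: xy => sh xy.
have yp : y \in x :: y :: p by rewrite !inE eqxx orbT.
have [by_ [e eE ye]] := pP y yp.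
have [_ [e' e'E xe]] := pP x (mem_head _ _).
have [c cx cy] : exists2 c : 'I_n, incident c x & incident c y.
  move: sh; rewrite xe => /orP[] H; [exists (esrc e')|exists (edst e')] => //.
    by rewrite incident_node eqxx.
  by rewrite incident_node eqxx orbT.
rewrite ye in wy cy xy by_ *.
exact: reach_incident (start c cx) xy by_ cy wy.
Qed.

End Reach.

(** A chain avoiding F would give a temporal path that departs at b or later and arrives before b +
    l. *)
Lemma cut_hits E F (U : seq node) (s z : 'I_n) l :
  s != z -> undirected E -> undirected F ->
  {subset U <= [seq node_of e | e in E]} ->
  ~ (exists e p, temporal_path (E :\: F) s z e p /\ travelling_time e p <= l) ->
  forall b, hits s z l U (fun x => x \in [seq node_of e | e in F]) b.
Proof.
move=> sz undE undF UE noP b x p pU sx pth; apply/negP => zx; apply: noP.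
have undEF : undirected (E :\: F).
  by move=> u v t; rewrite !inE undE undF.
have pE : {in x :: p, forall y,
    b <= time y /\ exists2 e, e \in E :\: F & y = node_of e}.
  move=> y yp; have /and3P[/UE/imageP[e eE ->] yF /andP[by_ _]] := pU y yp.
  split=> //; exists e => //; rewrite inE eE andbT.
  by apply: contra yF => eF; exact: image_f.
case: (reach_chain undEF pE sx pth zx) => [zs|[e [q [W be te]]]].
  by rewrite zs eqxx in sz.
exists e, q; split; first exact: simple_walk_temporal_path.
have /and3P[_ _ /andP[ge lt]] := pU _ (mem_last x p).
have l0 := leq_ltn_trans ge lt.
by have := leq_ltn_trans te lt; rewrite /travelling_time; lia.
Qed.

Lemma time_node e : time (node_of e) = etime e.
Proof. by []. Qed.

Definition orient (x : node) : node :=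
  if x.1 <= x.2.1 then x else (x.2.1, (x.1, x.2.2)).

Lemma incident_orient v x : incident v (orient x) = incident v x.
Proof. by rewrite /orient /incident; case: ifP => //= _; rewrite orbC. Qed.

Lemma time_orient x : time (orient x) = time x.
Proof. by rewrite /orient; case: ifP. Qed.

(** A short path gives a chain in the window that starts at its departure time. *)
Lemma hits_cut E F (U : seq node) (K : pred node) (s z : 'I_n) l :
  (forall e, e \in E -> orient (node_of e) \in U) ->
  (forall e, e \in E -> K (orient (node_of e)) -> e \in F) ->
  (forall b, hits s z l U K b) -> 0 < l ->
  ~ (exists e p, temporal_path (E :\: F) s z e p /\ travelling_time e p <= l).
Proof.
move=> EU KF hK l0 [e [p [/and5P[/allP pE /eqP se /eqP ze pth _] tt]]].
pose f (e : tedge 'I_n tau) := orient (node_of e).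
have fpth : path precedes (f e) (map f p).
  rewrite path_map; apply: sub_path pth => a c /andP[/eqP ac tac] /=.
  rewrite /precedes !time_orient tac andbT /f !incident_orient.
  have acI : incident (edst a) (node_of c) by rewrite incident_node ac eqxx.
  by rewrite {1 2}/orient; case: ifP => _ /=; rewrite acI ?orbT.
have := hK (etime e) (f e) (map f p) _ _ fpth.
rewrite -map_cons last_map !incident_orient !incident_node ze se !eqxx orbT.
move=> H; suff : false by []; apply: H => // y.
move=> yp; have /mapP[a ap ya] := yp.
case/andP: (path_precedes_time fpth yp) => lo hi.
have : a \in E :\: F by exact: pE.
rewrite inE => /andP[aF aE].
rewrite ya EU //=; apply/andP; split; first by apply: contra aF; exact: KF.
move: lo hi tt; rewrite ya last_map /f !time_orient !time_node /travelling_time.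
by move=> lo hi tt; rewrite lo /=; lia.
Qed.

End Conversion.

(** * Counting edges and the logarithmic factor *)

Lemma num_edges_le n tau (F : {set tedge 'I_n tau}) (es : seq (tedge 'I_n tau)) :
  (forall e, e \in F -> (e \in es) || (flip e \in es)) -> num_edges F <= size es.
Proof.
move=> Fes; rewrite /num_edges cardE.
rewrite -(size_map (fun e : tedge 'I_n tau => ([set esrc e; edst e], e.2))).
apply: uniq_leq_size (enum_uniq _) _ => D; rewrite mem_enum => /imsetP[e /Fes eP ->].
case/orP: eP => eP; apply/mapP; first by exists e.
by exists (flip e) => //; rewrite /flip /esrc /edst /= setUC.
Qed.

(** On edges with the smaller end first, passing to the unordered pair of ends and the time is
    injective. *)
Lemma le_num_edges n tau (F : {set tedge 'I_n tau}) (es : seq (tedge 'I_n tau)) :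
  uniq es -> (forall e, e \in es -> (esrc e <= edst e) && (e \in F)) ->
  size es <= num_edges F.
Proof.
move=> es_uniq esF; rewrite /num_edges cardE.
rewrite -(size_map (fun e : tedge 'I_n tau => ([set esrc e; edst e], e.2))).
apply: uniq_leq_size.
  rewrite map_inj_in_uniq // => -[[u v] t] [[u' v'] t'] /esF/andP[/= le _].
  move=> /esF/andP[/= le' _] [] /setP eqD ->; rewrite /esrc /edst /= in eqD le le'.
  have := eqD u; have := eqD v; have := eqD u'; have := eqD v'.
  rewrite !inE !eqxx !orbT -!val_eqE /= => c1 c2 c3 c4.
  by congr (_, _, _); apply: val_inj => /=; lia.
move=> D /mapP[e /esF/andP[_ eF] ->]; rewrite mem_enum.
by apply/imsetP; exists e.
Qed.

Import Order.TTheory GRing.Theory Num.Theory.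

(** For the bit length k, [2 ^ k.-1 <= l] gives k <= log2 (2 l), and k + 1 <= 2 k because k is
    positive. *)
Lemma size_bits_log2 (R : realType) l : 0 < l ->
  ((size (bits l)).+1%:R <= 2 * log2 (2 * l%:R) :> R)%R.
Proof.
move=> l0; set k := size (bits l).
have k0 : 0 < k.
  rewrite /k; case E: (bits l) => //; move: l0.
  by rewrite -(bitsK l) E.
have : (k%:R <= log2 (2 * l%:R) :> R)%R.
  have ln2 : (0 < ln 2 :> R)%R by rewrite ln_gt0 // ltr1n.
  rewrite /log2 ler_pdivlMr // [(k%:R * _)%R]mulr_natl -lnXn ?ltr0n //.
  rewrite ler_ln ?posrE ?exprn_gt0 ?ltr0n //.
    rewrite -natrX -natrM ler_nat; have := size_bits_le l0.
    by rewrite -/k -{2}(prednK k0) expnS leq_mul2l.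
  by rewrite -natrM ltr0n muln_gt0.
move=> H; apply: (@le_trans _ _ (2 * k%:R)%R).
  by rewrite -natrM ler_nat; lia.
by rewrite ler_pM2l // ltr0n.
Qed.

Theorem corollary19 (R : realType) :
  exists (alg : cmd) (c k : nat),
    forall (n : nat) (G : temporal_graph 'I_n)
           (es : seq (tedge 'I_n (lifetime G))) (s z : 'I_n) (l : nat),
      lists es (tedges G) -> s != z -> 0 < l <= lifetime G ->
      exists (F : {set tedge 'I_n (lifetime G)})
             (fs : seq (tedge 'I_n (lifetime G))) (T : nat),
        [/\ computes_in alg (enc_instance es s z l) T (enc_tedges fs),
            T <= c * tree_size (enc_instance es s z l) ^ k,
            lists fs F,
            is_temporal_cut s z l F &
            forall F' : {set tedge 'I_n (lifetime G)},
              is_temporal_cut s z l F' ->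
              ((num_edges F)%:R <=
                 2 * log2 (2 * l%:R) * (num_edges F')%:R :> R)%R].
Proof.
have [alg [N [c [k algP]]]] := ptime_solve.
(* [pol] is a power of the size plus one, which is at most twice the size; this gives the factor
   [2 ^ k]. *)
exists alg, (c * 2 ^ k), k => n G es s z l [es_uniq esP] sz /andP[l0 _].
set E := tedges G in esP *; have undE : undirected E := @tedges_undirected _ G.
set inst := enc_instance es s z l.
pose nodes := map (@node_of n (lifetime G)) es.
pose U := [seq x <- nodes | x.1 <= x.2.1].
pose r := (cut_levels s z l U).1.
pose sel (x : node) := has (eq_op x) r || has (eq_op (x.2.1, (x.1, x.2.2))) r.
pose fs := [seq e <- es | sel (node_of e)].
pose F := [set e in fs].
have nodes_uniq : uniq nodes by rewrite map_inj_uniq //; exact: node_of_inj.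
have U_uniq : uniq U by exact: filter_uniq.
have has_r x : has (eq_op x) r = (x \in r).
  by rewrite -has_pred1; apply: eq_has => y; exact: eq_sym.
have selE e : sel (node_of e) = (node_of e \in r) || (node_of (flip e) \in r).
  by rewrite /sel !has_r.
have FE e : (e \in F) = (e \in E) && sel (node_of e).
  by rewrite inE mem_filter andbC esP.
have encE : encode (iota 0 n, (lifetime G, (nodes, (s : nat, (z : nat, l))))) = inst.
  congr (Node _ (Node _ (Node _ _))).
  by rewrite /nodes; elim: (es) => //= e es' IH; congr Node.
have outE : encode (solve nodes s z l) = enc_tedges fs.
  rewrite /solve -/U -/r /fs /nodes filter_map.
  by elim: [seq _ <- _ | _] => //= e es' IH; congr Node.
have [comp _] := algP (iota 0 n, (lifetime G, (nodes, (s : nat, (z : nat, l))))).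
rewrite encE [X in computes _ _ _ _ X]outE in comp.
have [|T [st [ex st0 _ Tle]]] := comp (update (fun=> Leaf) 0 inst).
  by rewrite updateE eqxx.
exists F, fs, T; split.
- by exists st.
- apply: leq_trans Tle _; rewrite /pol -mulnA leq_mul2l -expnMn; apply/orP; right.
  case: k {algP comp} => // k; rewrite leq_exp2r //.
  by have := tree_size_gt0 inst; lia.
- by split; [exact: filter_uniq|move=> e; rewrite inE].
- split.
  + by apply/subsetP => e; rewrite FE => /andP[].
  + move=> u v t; rewrite !FE undE; congr andb.
    by rewrite !selE orbC.
  (* For the cut property any hitting set will do, so the full one is taken. *)
  + have K_hits b : hits s z l U xpredT b.
      by move=> x p /(_ _ (mem_head _ _)); rewrite /= andbF.
    have [_ r_hits] := cut_levelsP U_uniq K_hits.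
    apply: (hits_cut (U := U) (K := mem r)) r_hits l0 => e eE.
      rewrite mem_filter; apply/andP; split.
        by rewrite /orient; case: ifP => // /negbT; rewrite -ltnNge => /ltnW.
      rewrite /orient; case: ifP => _; first by apply: map_f; rewrite esP.
      by apply: (@map_f _ _ _ _ (flip e)); rewrite esP flip_mem.
    rewrite FE eE selE /orient; case: ifP => _ /= ->; rewrite ?orbT //.
move=> F' [F'E undF' noP].
pose K x := x \in [seq node_of e | e in F'].
have K_hits : forall b, hits s z l U K b.
  apply: (cut_hits sz undE undF' _ noP) => x; rewrite mem_filter => /andP[_].
  by case/mapP=> e eE ->; apply: image_f; rewrite -esP.
have [r_le _] := cut_levelsP U_uniq K_hits.
(* Every edge of F has an orientation in r. *)
have F_le : num_edges F <= size r.
  apply: leq_trans (num_edges_le (es := [seq e <- es | node_of e \in r]) _) _.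
    move=> e; rewrite FE selE !mem_filter !esP flip_mem // => /andP[-> /orP[] ->] //.
    by rewrite orbT.
  rewrite -(size_map (@node_of _ _)); apply: uniq_leq_size.
    by rewrite map_inj_uniq ?filter_uniq //; exact: node_of_inj.
  by move=> x /mapP[e]; rewrite mem_filter => /andP[+ _] ->.
(* U holds only one orientation of each edge, so no edge of [F'] is counted twice. *)
have F'_ge : count K U <= num_edges F'.
  rewrite /U /nodes filter_map count_map -size_filter.
  apply: le_num_edges; first by rewrite !filter_uniq.
  move=> e; rewrite !mem_filter => /and3P[/imageP[e' e'F eE] le _].
  by rewrite -(node_of_inj eE) in e'F; rewrite e'F andbT.
apply: (@le_trans _ _ (((size (bits l)).+1 * num_edges F')%:R)%R).
  rewrite ler_nat; apply: leq_trans F_le (leq_trans r_le _).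
  by rewrite leq_mul2l F'_ge orbT.
rewrite natrM ler_wpM2r ?ler0n //; exact: size_bits_log2.
Qed.
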